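(* Let $A\in\mathbb Z^{d\times n}$ be a normal matrix of rank $d$ as in the context. (i) If $d=1$ or $d=2$, or if $A$ is graded and $d=3$, then every regular triangulation of $cone(A)$ supports at least one Gomory family. (ii) If $d=2$ and $A$ is graded, then every regular triangulation of $cone(A)$ supports exactly one Gomory family. (iii) There exist such matrices $A$ with $d=3$ and $A$ not graded, and also with $d=4$ and $A$ graded, for which some regular triangulation of $cone(A)$ supports no Gomory family; in particular such an $A$ need not be $\Delta$-normal with respect to every regular triangulation $\Delta$.
   Context: $A\in\mathbb Z^{d\times n}$ has rank $d$, columns $a_1,\dots,a_n$, $cone(A)$ pointed, $\{x\in\mathbb R^n_{\ge0}:Ax=0\}=\{0\}$, $\mathbb ZA=\mathbb Z^d$, $\mathbb NA=\{Au:u\in\mathbb N^n\}$. Standing assumption: $A$ is normal ($\mathbb NA=cone(A)\cap\mathbb Z^d$) and its columns form the unique minimal Hilbert basis of $cone(A)$. $A$ is graded if its columns lie on an affine hyperplane of $\mathbb R^d$ not through the origin. For $c\in\mathbb R^n$, $\Delta_c$ is the collection of $\sigma\subseteq\{1,\dots,n\}$ (cones $cone(A_\sigma)$) for which some $y\in\mathbb R^d$ has $y\cdot a_j=c_j$ ($j\in\sigma$), $y\cdot a_j<c_j$ ($j\notin\sigma$); a triangulation is regular if it equals some $\Delta_c$. A cost vector $c$ is generic if $\Delta_c$ is a triangulation and every program $IP_{A,c}(b)=\min\{c\cdot x: Ax=b,\ x\in\mathbb N^n\}$, $b\in\mathbb NA$, has a unique optimal solution; $IP_{A,c}$ is the family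 of these programs and $\mathcal O_c$ the set of their optimal solutions. Two generic $c,c'$ give the same family if $\mathcal O_c=\mathcal O_{c'}$. For a maximal face $\sigma$ of $\Delta_c$ let $\tilde c_{\bar\sigma}=c_{\bar\sigma}-c_\sigma A_\sigma^{-1}A_{\bar\sigma}$; the group relaxation $G^\sigma(b)$ is $\min\{\tilde c_{\bar\sigma}\cdot x_{\bar\sigma}: A_\sigma x_\sigma+A_{\bar\sigma}x_{\bar\sigma}=b,\ x_{\bar\sigma}\ge0,\ x\in\mathbb Z^n\}$, which solves $IP_{A,c}(b)$ if its optimal solution is non-negative. $IP_{A,c}$ is a Gomory family if for every $b\in\mathbb NA$ some maximal face $\sigma$ of $\Delta_c$ has $G^\sigma(b)$ solving $IP_{A,c}(b)$. A triangulation $\Delta$ supports the Gomory family $IP_{A,c}$ (equivalently the set $\mathcal O_c$) if $c$ is generic, $\Delta=\Delta_c$ and $IP_{A,c}$ is a Gomory family; ''exactly one'' counts distinct sets $\mathcal O_c$. $A$ is $\Delta$-normal if for each maximal face $\sigma$ of $\Delta$ the columns of $A$ lying in $cone(A_\sigma)$ form a Hilbert basis of $cone(A_\sigma)$. *)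

(* Defs.v *)
From HB Require Import structures.
From mathcomp Require Import all_boot all_order all_algebra.
From mathcomp Require Import Rstruct.
From Stdlib Require Import Rdefinitions.

Set Implicit Arguments.
Unset Strict Implicit.
Unset Printing Implicit Defensive.

Import Order.TTheory GRing.Theory Num.Theory.
Local Open Scope ring_scope.

Notation RR := Rdefinitions.R.

Section Gomory.
Variables (d n : nat) (A : 'M[int]_(d, n)).

Definition Ar : 'M[RR]_(d, n) := map_mx (fun z : int => z%:~R) A.
Definition intcv m (b : 'cV[int]_m) : 'cV[RR]_m := map_mx (fun z : int => z%:~R) b.

Definition nonneg_vec m (u : 'cV[int]_m) : Prop := forall j, 0 <= u j 0.

Definition cone_of (sigma : {set 'I_n}) (v : 'cV[RR]_d) : Prop :=
  exists l : 'I_n -> RR,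
    (forall j, 0 <= l j) /\ (forall j, j \notin sigma -> l j = 0) /\
    v = \sum_j l j *: col j Ar.

Definition inNA (b : 'cV[int]_d) : Prop :=
  exists u : 'cV[int]_n, nonneg_vec u /\ A *m u = b.

Definition hilbert_basis_cols (H : 'I_n -> Prop) (K : 'cV[RR]_d -> Prop) : Prop :=
  (forall j, H j -> K (col j Ar)) /\
  (forall b : 'cV[int]_d, K (intcv b) ->
     exists u : 'cV[int]_n, nonneg_vec u /\ (forall j, ~ H j -> u j 0 = 0) /\
       A *m u = b).

Definition standing : Prop :=
  [/\ \rank Ar = d /\
      (forall v, cone_of setT v -> cone_of setT (- v) -> v = 0),
      (forall x : 'cV[RR]_n, (forall j, 0 <= x j 0) -> Ar *m x = 0 -> x = 0),
      (forall b : 'cV[int]_d, exists u : 'cV[int]_n, A *m u = b),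
      (forall b : 'cV[int]_d, inNA b <-> cone_of setT (intcv b)) &
      [/\ injective (fun j : 'I_n => col j A),
          hilbert_basis_cols (fun _ => True) (cone_of setT) &
          (forall H : {set 'I_n},
             hilbert_basis_cols (fun j => j \in H) (cone_of setT) -> H = setT)]].

Definition graded : Prop :=
  exists (w : 'rV[RR]_d) (t : RR), t != 0 /\ forall j, (w *m col j Ar) 0 0 = t.

Definition Delta (c : 'rV[RR]_n) (sigma : {set 'I_n}) : Prop :=
  exists y : 'rV[RR]_d, forall j,
    (j \in sigma -> (y *m col j Ar) 0 0 = c 0 j) /\
    (j \notin sigma -> (y *m col j Ar) 0 0 < c 0 j).

Definition is_triangulation (D : {set 'I_n} -> Prop) : Prop :=
  [/\ (forall sigma tau : {set 'I_n}, D sigma -> tau \subset sigma -> D tau),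
      (forall sigma, D sigma -> forall l : 'I_n -> RR,
          (forall j, j \notin sigma -> l j = 0) ->
          \sum_j l j *: col j Ar = 0 -> forall j, l j = 0),
      (forall v, cone_of setT v <-> exists sigma, D sigma /\ cone_of sigma v) &
      (forall sigma tau v, D sigma -> D tau -> cone_of sigma v -> cone_of tau v ->
          cone_of (sigma :&: tau) v)].

Definition regular_triangulation (D : {set 'I_n} -> Prop) : Prop :=
  is_triangulation D /\ exists c : 'rV[RR]_n, forall sigma, D sigma <-> Delta c sigma.

Definition max_face (D : {set 'I_n} -> Prop) (sigma : {set 'I_n}) : Prop :=
  D sigma /\ forall tau : {set 'I_n}, D tau -> sigma \subset tau -> tau = sigma.

Definition cost (c : 'rV[RR]_n) (x : 'cV[int]_n) : RR := (c *m intcv x) 0 0.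

Definition feasIP (b : 'cV[int]_d) (x : 'cV[int]_n) : Prop :=
  nonneg_vec x /\ A *m x = b.

Definition optIP (c : 'rV[RR]_n) (b : 'cV[int]_d) (x : 'cV[int]_n) : Prop :=
  feasIP b x /\ forall x', feasIP b x' -> cost c x <= cost c x'.

Definition generic (c : 'rV[RR]_n) : Prop :=
  is_triangulation (Delta c) /\
  forall b, inNA b -> exists! x, optIP c b x.

Definition Oc (c : 'rV[RR]_n) (x : 'cV[int]_n) : Prop :=
  exists b, inNA b /\ optIP c b x.

(* group relaxation G^sigma(b).  y plays the role of c_sigma A_sigma^{-1},
   i.e. y A_sigma = c_sigma; the reduced cost is
   ctilde_j = c_j - y a_j for j notin sigma. *)
Definition gcost (c : 'rV[RR]_n) (sigma : {set 'I_n}) (y : 'rV[RR]_d)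
    (x : 'cV[int]_n) : RR :=
  \sum_(j | j \notin sigma) (c 0 j - (y *m col j Ar) 0 0) * (x j 0)%:~R.

Definition feasG (sigma : {set 'I_n}) (b : 'cV[int]_d) (x : 'cV[int]_n) : Prop :=
  (forall j, j \notin sigma -> 0 <= x j 0) /\ A *m x = b.

Definition optG c sigma y b x : Prop :=
  feasG sigma b x /\ forall x', feasG sigma b x' -> gcost c sigma y x <= gcost c sigma y x'.

Definition G_solves (c : 'rV[RR]_n) (sigma : {set 'I_n}) (b : 'cV[int]_d) : Prop :=
  forall y : 'rV[RR]_d, (forall j, j \in sigma -> (y *m col j Ar) 0 0 = c 0 j) ->
    exists x, optG c sigma y b x /\ nonneg_vec x.

Definition gomory_family (c : 'rV[RR]_n) : Prop :=
  forall b, inNA b -> exists sigma, max_face (Delta c) sigma /\ G_solves c sigma b.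

Definition supports (D : {set 'I_n} -> Prop) (c : 'rV[RR]_n) : Prop :=
  [/\ generic c, (forall sigma, D sigma <-> Delta c sigma) & gomory_family c].

Definition Delta_normal (D : {set 'I_n} -> Prop) : Prop :=
  forall sigma, max_face D sigma ->
    hilbert_basis_cols (fun j => cone_of sigma (col j Ar)) (cone_of sigma).

End Gomory.

(* Main.v *)
Require Import Defs.
From HB Require Import structures.
From mathcomp Require Import all_boot all_order all_algebra.
From mathcomp Require Import boolp reals Rstruct.
From mathcomp Require Import ring lra zify.
From Stdlib Require Import Classical.
Import Order.TTheory GRing.Theory Num.Theory.
Local Open Scope ring_scope.
Set Implicit Arguments.
Unset Strict Implicit.
Unset Printing Implicit Defensive.

(** Existence in (i) follows from Delta-normality. If f is the piecewise linear
    function given by the heights of Delta and g the one equal to 1 on the vertices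
    of Delta, the cost [f + e * g] on non-vertices (and f on vertices) makes, for
    small e > 0, every group relaxation prefer columns inside its own cell, and among
    those the solutions whose coordinates along the cell are largest; Delta-normality
    says that the best conceivable value is attained by a nonnegative solution. A
    small perturbation with rationally independent entries gives genericity.
    Delta-normality in low dimension: a simplicial cone on columns with determinant
    > 1 contains a column with all coordinates in [0,1), and one star-subdivides.

    For (ii), every class modulo a cell is 0 or an interior column, and each interior
    column is forced to be optimal in its own cell, which determines the optima.

    For (iii), in the triangulations below some b has a single feasible point, and each
    cell admits a cheaper group-feasible point for all costs inducing the
    triangulation. They cannot be Delta-normal because of the construction for (i). *)

(** * Regular subdivisions and weak duality *)

(** The given heights cannot serve as the cost: on a non-vertex they only have to exceed [f], and a
    dear inner column may drive a group relaxation to negative generator coordinates instead.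
    Lowering them to [f] itself would let non-vertices join the cells, hence the small excess. Its
    shape [e * g] turns the reduced cost of an inner column into [e] times the sum of its
    coordinates, so the group cost measures how much of the right-hand side is not carried by the
    generators. Without a grading, the plane case rests on irreducibility of the columns. With one,
    degrees take over: cone points of degree below 2 are 0 or columns, and the central symmetry of a
    parallelepiped on three generators moves degree 2 to degree 1. On four generators a point of
    degree 2 can sit at the centre, fixed by the symmetry; there the graded example lives. In both
    examples all columns are vertices, one cell has index 2, and [b] is half the sum of the
    generators of that cell. *)

Lemma col_mul (R : pzSemiRingType) m n p (j : 'I_p) (B : 'M[R]_(m, n)) (C : 'M_(n, p)) :
  col j (B *m C) = B *m col j C.
Proof. by apply/colP => i; rewrite !mxE; apply: eq_bigr => k _; rewrite mxE. Qed.

Section Subdivisions.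
Variables (d n : nat) (A : 'M[int]_(d, n)).
Implicit Types (c : 'rV[RR]_n) (y : 'rV[RR]_d) (sigma tau : {set 'I_n}).

Definition pairing y (j : 'I_n) : RR := (y *m col j (Ar A)) 0 0.

Definition witness c sigma y : Prop := forall j,
  (j \in sigma -> pairing y j = c 0 j) /\ (j \notin sigma -> pairing y j < c 0 j).

Definition comb (l : 'I_n -> RR) : 'cV[RR]_d := \sum_j l j *: col j (Ar A).

Lemma combE l : comb l = Ar A *m (\col_j l j).
Proof.
apply/colP => i; rewrite mxE summxE; apply: eq_bigr => j _.
by rewrite !mxE mulrC.
Qed.

Lemma mul_comb y l : (y *m comb l) 0 0 = \sum_j l j * pairing y j.
Proof.
rewrite mulmx_sumr summxE; apply: eq_bigr => j _.
by rewrite -scalemxAr mxE.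
Qed.

Lemma mulAr y j : (y *m Ar A) 0 j = pairing y j.
Proof. by rewrite /pairing -col_mul [in RHS]mxE. Qed.

Lemma pairD y y' j : pairing (y + y') j = pairing y j + pairing y' j.
Proof. by rewrite /pairing mulmxDl mxE. Qed.

Lemma pairZ a y j : pairing (a *: y) j = a * pairing y j.
Proof. by rewrite /pairing -scalemxAl mxE. Qed.

Lemma pair_intcv y (x : 'cV[int]_n) :
  (y *m intcv (A *m x)) 0 0 = \sum_j pairing y j * (x j 0)%:~R.
Proof.
rewrite /intcv map_mxM mulmxA mxE; apply: eq_bigr => j _.
by rewrite -[map_mx _ A]/(Ar A) mulAr mxE.
Qed.

Lemma costE c (x : 'cV[int]_n) : cost c x = \sum_j c 0 j * (x j 0)%:~R.
Proof. by rewrite /cost mxE; apply: eq_bigr => j _; rewrite mxE. Qed.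

Lemma cost_gcost c sigma y (x : 'cV[int]_n) :
  (forall j, j \in sigma -> pairing y j = c 0 j) ->
  cost c x = (y *m intcv (A *m x)) 0 0 + gcost A c sigma y x.
Proof.
move=> hy; rewrite costE pair_intcv /gcost.
rewrite [X in _ = _ + X]big_mkcond -big_split /=; apply: eq_bigr => j _.
case: ifP => [_|/negbFE hj]; last by rewrite hy // addr0.
by rewrite -/(pairing y j); ring.
Qed.

(* Weak duality for min {c.x : Ax = v, x >= 0}: both representations of v have
   the same cost, so the slack c - yA vanishes on the support of the second. *)
Lemma Delta_support c sigma tau l l' :
  Delta A c sigma -> Delta A c tau ->
  (forall j, j \notin sigma -> l j = 0) -> (forall j, 0 <= l j) ->
  (forall j, j \notin tau -> l' j = 0) -> (forall j, 0 <= l' j) ->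
  comb l = comb l' -> forall j, j \notin sigma -> l' j = 0.
Proof.
move=> [y hy] [y' hy'] sl pl sl' pl' e.
have dual (s : {set 'I_n}) z k k' : witness c s z ->
    (forall j, j \notin s -> k j = 0) -> (forall j, 0 <= k' j) ->
    comb k = comb k' ->
    \sum_j k' j * (c 0 j - pairing z j) = \sum_j k' j * c 0 j - \sum_j k j * c 0 j.
  move=> hz sk pk' ek.
  have -> : \sum_j k j * c 0 j = \sum_j k j * pairing z j.
    apply: eq_bigr => j _; have [hj|hj] := boolP (j \in s); last by rewrite sk // !mul0r.
    by rewrite ((hz j).1 hj).
  by rewrite -mul_comb ek mul_comb -sumrB; apply: eq_bigr => j _; rewrite mulrBr.
have pos (s : {set 'I_n}) z k' : witness c s z -> (forall j, 0 <= k' j) ->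
    forall j, 0 <= k' j * (c 0 j - pairing z j).
  move=> hz pk j; apply: mulr_ge0 => //; rewrite subr_ge0.
  have [hj|hj] := boolP (j \in s); first by rewrite ((hz j).1 hj).
  by apply: ltW; apply: (hz j).2.
have h1 := dual _ _ _ _ hy sl pl' e.
have h2 := dual _ _ _ _ hy' sl' pl (esym e).
have s0 : \sum_j l' j * (c 0 j - pairing y j) = 0.
  apply/eqP; rewrite eq_le; apply/andP; split; last first.
    by apply: sumr_ge0 => j _; exact: (pos _ _ _ hy pl' j).
  rewrite h1 -opprB oppr_le0 -h2; apply: sumr_ge0 => j _; exact: (pos _ _ _ hy' pl j).
move=> j hj; have /eqP := s0.
rewrite (psumr_eq0 _ (fun i _ => pos _ _ _ hy pl' i)).
move=> /allP/(_ j (mem_index_enum j)) /=; rewrite mulf_eq0 => /orP[/eqP //|].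
by rewrite subr_eq0 => /eqP ec; have := (hy j).2 hj; rewrite ec ltxx.
Qed.

Lemma cone_comb sigma v : cone_of A sigma v <->
  exists l, [/\ forall j, 0 <= l j, forall j, j \notin sigma -> l j = 0 & v = comb l].
Proof.
split; first by case=> l [h1 [h2 h3]]; exists l.
by case=> l [h1 h2 h3]; exists l.
Qed.

Lemma Delta_inter c sigma tau v : Delta A c sigma -> Delta A c tau ->
  cone_of A sigma v -> cone_of A tau v -> cone_of A (sigma :&: tau) v.
Proof.
move=> hs ht /cone_comb[l [pl sl el]] /cone_comb[l' [pl' sl' el']].
apply/cone_comb; exists l'; split=> // j; rewrite inE negb_and => /orP[|/sl' //].
by apply: (Delta_support hs ht sl pl sl' pl'); rewrite -el -el'.
Qed.

(** The sum of the columns of [tau] uses each of them with a positive coefficient, so weak duality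
    puts each into [sigma]. *)
Lemma Delta_sub c sigma tau : Delta A c sigma -> Delta A c tau ->
  cone_of A sigma (comb (fun j => (j \in tau)%:R)) -> tau \subset sigma.
Proof.
move=> hs ht /cone_comb[l [pl sl el]]; apply/subsetP => j jt; apply/negPn/negP => js.
have h i : i \notin tau -> (i \in tau)%:R = 0 :> RR by move=> /negbTE ->.
have := Delta_support hs ht sl pl h (fun j => ler0n _ _) (esym el) js.
by rewrite jt => /eqP; rewrite oner_eq0.
Qed.

Definition indep sigma : Prop := forall l : 'I_n -> RR,
  (forall j, j \notin sigma -> l j = 0) -> comb l = 0 -> forall j, l j = 0.

(* M plays the role of the inverse of A_sigma, padded with zero rows. *)
Definition dual_basis sigma (M : 'M[RR]_(n, d)) : Prop :=
  (forall j k, j \notin sigma -> M j k = 0) /\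
  (forall i k, i \in sigma -> (M *m col i (Ar A)) k 0 = (k == i)%:R).

(** With [E] the projection onto the coordinates in [sigma], independence says that [E] kills the
    kernel of [Ar A *m E]. Hence the rows of [E] are combinations of the rows of [Ar A *m E], and
    the coefficients form the inverse. *)
Lemma indep_dual_basis sigma : indep sigma -> exists M, dual_basis sigma M.
Proof.
move=> ind; pose E : 'M[RR]_n := diag_mx (\row_j (j \in sigma)%:R).
have EE i j : E i j = ((i == j) && (j \in sigma))%:R.
  by rewrite !mxE; case: eqP => [->|]; rewrite ?mulr1n ?mulr0n.
have colE m (B : 'M[RR]_(n, m)) i k : (E *m B) i k = (i \in sigma)%:R * B i k.
  by rewrite mul_diag_mx !mxE.
have : (E <= Ar A *m E)%MS.
  rewrite submxE; apply/eqP/matrixP => i k; rewrite colE.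
  set C := cokermx _; have [hi|_] := boolP (i \in sigma); last by rewrite mul0r mxE.
  pose l j := (j \in sigma)%:R * C j k.
  have := ind l; have -> : comb l = 0.
    have -> : comb l = col k (Ar A *m E *m C).
      rewrite col_mul -mulmxA combE; congr (_ *m _); apply/colP => j.
      by rewrite colE [LHS]mxE [X in _ = _ * X]mxE.
    by rewrite mulmx_coker; apply/colP => ?; rewrite !mxE.
  move=> /(_ _ erefl i); rewrite /l hi => -> //; first by rewrite mxE.
  by move=> j /negbTE hj; rewrite hj mul0r.
case/submxP => M0 hM0; exists (E *m M0); split=> [j k /negbTE hj|i k hi].
  by rewrite colE hj mul0r.
rewrite -mulmxA colE -col_mul mxE.
have := congr1 (fun B : 'M_n => B k i) hM0; rewrite mulmxA EE hi andbT.
have -> : (M0 *m Ar A *m E) k i = (M0 *m Ar A) k i.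
  by rewrite mul_mx_diag !mxE hi mulr1.
by move=> <-; case: eqP => [->|_]; rewrite ?hi ?mul1r ?mulr0.
Qed.

End Subdivisions.

(** The reciprocal of 1 plus the sum of all reciprocals stands in for a minimum: it lies below every
    threshold and is positive also when [T] is empty. *)
Lemma pos_uniform (T : finType) (P : T -> RR -> Prop) :
  (forall t, exists2 e, 0 < e & forall e', 0 < e' <= e -> P t e') ->
  exists2 e, 0 < e & forall t, P t e.
Proof.
move=> h; have [f f0 fP] := fin_all_exists2 h.
have S0 (t : T) : (f t)^-1 <= 1 + \sum_t (f t)^-1.
  rewrite (bigD1 t) //= addrCA lerDl addr_ge0 // sumr_ge0 // => i _.
  by rewrite invr_ge0 ltW.
have D0 : 0 < 1 + \sum_t (f t)^-1.
  by rewrite ltr_pwDl // sumr_ge0 // => i _; rewrite invr_ge0 ltW.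
exists (1 + \sum_t (f t)^-1)^-1; first by rewrite invr_gt0.
move=> t; apply: fP; rewrite invr_gt0 D0 -(invrK (f t)).
by rewrite lef_pV2 ?posrE ?invr_gt0 ?f0 ?S0.
Qed.

Lemma exists_max_face n (D : {set 'I_n} -> Prop) sigma : D sigma ->
  exists tau, max_face D tau /\ sigma \subset tau.
Proof.
have [k] := ubnP #|~: sigma|; elim: k sigma => // k IH sigma hk hs.
case: (classic (max_face D sigma)) => [m|nm]; first by exists sigma.
have [tau [ht st ne]] : exists tau, [/\ D tau, sigma \subset tau & tau <> sigma].
  apply: NNPP => nex; apply: nm; split=> // tau ht st.
  by apply: NNPP => ne; apply: nex; exists tau.
have pr : sigma \proper tau.
  by rewrite properEneq st andbT; apply/eqP => e; apply: ne.
case: (IH tau _ ht) => [|rho [mr tr]].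
  by apply: leq_trans (proper_card _) hk; rewrite properC.
by exists rho; split=> //; apply: subset_trans st tr.
Qed.

(** * Maximal faces and their group relaxations *)

Section Faces.
Variables (d n : nat) (A : 'M[int]_(d, n)).
Implicit Types (c : 'rV[RR]_n) (y : 'rV[RR]_d) (sigma tau : {set 'I_n}).

(* If some z <> 0 vanishes on A_sigma, moving a witness y along z until the
   first new constraint becomes tight enlarges sigma. *)
Lemma max_face_spanning c sigma : \rank (Ar A) = d -> max_face (Delta A c) sigma ->
  forall z : 'rV[RR]_d, (forall j, j \in sigma -> pairing A z j = 0) -> z = 0.
Proof.
move=> rk [[y hy] mx] z0 hz0; have {}hy : witness A c sigma y := hy.
apply: NNPP => /eqP nz.
have [z hz [j0 hj0]] : exists2 z : 'rV_d, (forall j, j \in sigma -> pairing A z j = 0)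
    & exists j, 0 < pairing A z j.
  have fr : row_free (Ar A) by rewrite /row_free rk.
  have : z0 *m Ar A != 0 by rewrite -(mul0mx _ (Ar A)) (inj_eq (row_free_inj fr)).
  move=> /eqP/matrixP ne; have [j hj] : exists j, pairing A z0 j != 0.
    apply: NNPP => nex; apply: ne => i j; rewrite ord1 mulAr mxE.
    by apply/eqP/negPn/negP => hj; apply: nex; exists j.
  have [hp|hp|/esym e] := ltgtP 0 (pairing A z0 j); first by exists z0 => //; exists j.
    exists (-1 *: z0); last by exists j; rewrite pairZ mulN1r oppr_gt0.
    by move=> i hi; rewrite pairZ hz0 // mulr0.
  by rewrite e eqxx in hj.
pose F j := (c 0 j - pairing A y j) / pairing A z j.
case: (@arg_minP _ _ _ j0 (fun j => 0 < pairing A z j) F hj0) => i hi mi.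
pose y' := y + F i *: z.
have e' j : pairing A y' j = pairing A y j + F i * pairing A z j by rewrite pairD pairZ.
have Fi0 : 0 <= F i.
  rewrite divr_ge0 ?(ltW hi) // subr_ge0; have [h|h] := boolP (i \in sigma).
    by rewrite ((hy i).1 h).
  by apply: ltW; apply: (hy i).2.
have le' j : pairing A y' j <= c 0 j.
  have le : pairing A y j <= c 0 j.
    have [h|h] := boolP (j \in sigma); first by rewrite ((hy j).1 h).
    by apply: ltW; apply: (hy j).2.
  rewrite e'; have [hj|hj] := ltP 0 (pairing A z j).
    by rewrite -lerBrDl -ler_pdivlMr // mi.
  by rewrite (le_trans _ le) // gerDl mulr_ge0_le0.
pose tau := [set j | pairing A y' j == c 0 j].
have st : sigma \subset tau.
  apply/subsetP => j hj; rewrite inE e' hz // mulr0 addr0.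
  by rewrite ((hy j).1 hj).
have e : tau = sigma.
  apply: mx st; exists y' => j; split; rewrite inE; first by move/eqP.
  by move=> h; rewrite lt_neqAle; apply/andP; split; [exact: h|exact: le'].
have : i \in sigma by rewrite -e inE e' /F divfK ?(gt_eqF hi) //; apply/eqP; ring.
by move=> /hz zi; rewrite zi ltxx in hi.
Qed.

(** The last equation says that A_sigma also spans, so that [c *m M] is the row vector c_sigma
    A_sigma^-1 of the group relaxation. *)
Definition inverse_on sigma (M : 'M[RR]_(n, d)) : Prop :=
  dual_basis A sigma M /\ Ar A *m M = 1%:M.

(** Independence gives a left inverse. Each row of A M - 1 vanishes on A_sigma, and maximality makes
    such a row zero. *)
Lemma max_face_inverse c sigma : \rank (Ar A) = d -> is_triangulation A (Delta A c) ->
  max_face (Delta A c) sigma -> exists M, inverse_on sigma M.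
Proof.
move=> rk [_ ind _ _] mf; have [M dM] := indep_dual_basis (ind _ mf.1).
exists M; split=> //; apply/row_matrixP => i; apply/eqP.
rewrite -subr_eq0 -linearB /=; apply/eqP.
apply: (max_face_spanning rk mf) => j hj.
rewrite /pairing rowE -mulmxA mulmxBl mul1mx -mulmxA.
have -> : M *m col j (Ar A) = delta_mx j 0.
  by apply/colP => k; rewrite (dM.2 _ _ hj) mxE eqxx andbT.
by rewrite -colE subrr mulmx0 mxE.
Qed.

Section Inverse.
Variables (sigma : {set 'I_n}) (M : 'M[RR]_(n, d)).
Hypothesis hM : inverse_on sigma M.

Lemma inv_col i : i \in sigma -> M *m col i (Ar A) = delta_mx i 0.
Proof. by move=> hi; apply/colP => k; rewrite (hM.1.2 _ _ hi) mxE eqxx andbT. Qed.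

Lemma inv_pair c i : i \in sigma -> pairing A (c *m M) i = c 0 i.
Proof. by move=> hi; rewrite /pairing -mulmxA inv_col // -colE mxE. Qed.

Lemma inv_pairE c y : (forall i, i \in sigma -> pairing A y i = c 0 i) -> y = c *m M.
Proof.
move=> h; rewrite -(mulmx1 y) -hM.2 mulmxA; apply/rowP => k; rewrite [LHS]mxE [RHS]mxE.
apply: eq_bigr => i _; rewrite mulAr.
by have [hi|hi] := boolP (i \in sigma); [rewrite h|rewrite (hM.1.1 _ _ hi) !mulr0].
Qed.

Lemma inv_out (v : 'cV[RR]_d) k : k \notin sigma -> (M *m v) k 0 = 0 :> RR.
Proof.
by move=> hk; rewrite mxE big1 // => i _; rewrite (hM.1.1 _ _ hk) mul0r.
Qed.

Lemma inv_comb l : (forall j, j \notin sigma -> l j = 0) ->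
  forall k, (M *m comb A l) k 0 = l k.
Proof.
move=> hl k; rewrite mulmx_sumr summxE (bigD1 k) //= big1 => [|j jk].
  have [hk|hk] := boolP (k \in sigma); last by rewrite hl // scale0r mulmx0 mxE addr0.
  by rewrite -scalemxAr inv_col // !mxE !eqxx mulr1 addr0.
have [hj|hj] := boolP (j \in sigma); last by rewrite hl // scale0r mulmx0 mxE.
by rewrite -scalemxAr inv_col // !mxE eq_sym (negbTE jk) mulr0.
Qed.

Lemma comb_inv v : comb A (fun k => (M *m v) k 0) = v.
Proof.
rewrite combE -[RHS]mul1mx -hM.2 -mulmxA; congr (_ *m _).
by apply/colP => k; rewrite !mxE.
Qed.

Lemma coneP v : cone_of A sigma v <-> (forall k, 0 <= (M *m v) k 0).
Proof.
split; first by case=> l [l0 [ls ->]] k; rewrite -/(comb A l) inv_comb.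
move=> h; exists (fun k => (M *m v) k 0); split=> //; split; first exact: inv_out.
by rewrite -/(comb A _) comb_inv.
Qed.

End Inverse.

(* The set of feasible x with gcost x <= gcost x0 need not be finite, but gcost
   only sees the coordinates off sigma and these are bounded. *)
Lemma optG_exists c sigma y b x0 :
  (forall j, j \notin sigma -> pairing A y j < c 0 j) -> feasG A sigma b x0 ->
  exists x, optG A c sigma y b x.
Proof.
move=> hc f0; pose r j := c 0 j - pairing A y j.
have r0 j : j \notin sigma -> 0 < r j by move=> hj; rewrite subr_gt0 hc.
(* Cost at most that of [x0] bounds x_j by the quotient below. Only the coordinates off [sigma] are
   recorded; [P] asks for some integer completion on [sigma]. *)
pose K := \max_j Num.bound (gcost A c sigma y x0 / r j).
pose G (f : {ffun 'I_n -> 'I_K.+1}) : RR := \sum_(j | j \notin sigma) r j * (f j)%:R.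
pose P (f : {ffun 'I_n -> 'I_K.+1}) := `[< exists2 x, feasG A sigma b x &
  forall j, j \notin sigma -> x j 0 = (f j)%:Z >].
have box x : feasG A sigma b x -> gcost A c sigma y x <= gcost A c sigma y x0 ->
    exists2 f, P f & gcost A c sigma y x = G f.
  move=> fx le; have bd j : j \notin sigma -> (`|x j 0%R| < K.+1)%N.
    move=> hj; rewrite ltnS; apply: leq_trans (leq_bigmax j).
    have : (x j 0)%:~R * r j <= gcost A c sigma y x0.
      apply: le_trans le; rewrite /gcost (bigD1 j) //= mulrC lerDl.
      apply: sumr_ge0 => i /andP[hi _]; rewrite mulr_ge0 ?ler0z ?fx.1 //.
      exact: ltW (r0 _ hi).
    rewrite -ler_pdivlMr ?r0 // => h.
    have q0 : 0 <= gcost A c sigma y x0 / r j.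
      by apply: le_trans h; rewrite ler0z fx.1.
    have := le_lt_trans h (archi_boundP q0).
    by have := fx.1 _ hj; case: (x j 0) => // m _; rewrite -[(Posz m)%:~R]/(m%:R) ltr_nat => /ltnW.
  pose f := [ffun j => inord `|x j 0| : 'I_K.+1].
  have ef j : j \notin sigma -> x j 0 = (f j)%:Z.
    by move=> hj; rewrite ffunE inordK ?bd // gez0_abs // fx.1.
  exists f; first by apply/asboolP; exists x.
  by apply: eq_bigr => j hj; rewrite ef.
have [f Pf ef] := box _ f0 (lexx _).
case: (@arg_minP _ _ _ f P G Pf) => g /asboolP[x fx ex] mg.
have gx : gcost A c sigma y x = G g by apply: eq_bigr => j hj; rewrite ex.
exists x; split=> // x' fx'; have [le|lt] := leP (gcost A c sigma y x') (gcost A c sigma y x0).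
  by have [h Ph ->] := box _ fx' le; rewrite gx mg.
by apply: le_trans (ltW lt); rewrite gx ef mg.
Qed.

Lemma optG_optIP c sigma y b x :
  (forall j, j \in sigma -> pairing A y j = c 0 j) ->
  optG A c sigma y b x -> nonneg_vec x -> optIP A c b x.
Proof.
move=> hy [fx ox] nx; split=> [|x' [nx' ex']]; first by split=> //; apply: fx.2.
rewrite !(cost_gcost _ hy) fx.2 ex' lerD2l; apply: ox; split=> // j _; apply: nx'.
Qed.

End Faces.

(** * A cost solved cell by cell *)

(** Cantor's nested intervals: each step keeps a closed subinterval that misses the next term.
    Starting in the middle third keeps the limit strictly between [a] and [b]. *)
Lemma avoid_sequence (f : nat -> RR) (a b : RR) : a < b ->
  exists2 z, a < z < b & forall k, f k <> z.
Proof.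
move=> ab.
pose step (I : RR * RR) x := let m := (I.1 + I.2) / 2 in
  if x <= m then ((m + I.2) / 2, I.2) else (I.1, m).
pose I0 := ((2 * a + b) / 3, (a + 2 * b) / 3).
pose I := fix I k := if k is k'.+1 then step (I k') (f k') else I0.
have stepP J x : J.1 < J.2 ->
    [/\ J.1 <= (step J x).1, (step J x).1 < (step J x).2, (step J x).2 <= J.2
      & ~ ((step J x).1 <= x <= (step J x).2)].
  rewrite /step; case: (leP x ((J.1 + J.2) / 2)) => h /= hJ; split; lra.
have lt k : (I k).1 < (I k).2.
  by elim: k => [|k IH] /=; [rewrite /I0 /=; lra|case: (stepP _ (f k) IH)].
have mono k i : (I k).1 <= (I (k + i)%N).1 /\ (I (k + i)%N).2 <= (I k).2.
  elim: i => [|i [h1 h2]]; first by rewrite addn0.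
  by rewrite addnS /=; case: (stepP _ (f (k + i)%N) (lt (k + i)%N)) => *; split; lra.
have cross k i : (I k).1 <= (I i).2.
  have [h1 _] := mono k i; have [_ h2] := mono i k; rewrite addnC in h2.
  by have := lt (k + i)%N; lra.
pose E : classical_sets.set RR := fun x => exists k, x = (I k).1.
have E0 : classical_sets.nonempty E by exists (I 0%N).1, 0%N.
have ubE k : classical_sets.ubound E (I k).2 by move=> _ [i ->].
have lo k : (I k).1 <= sup E.
  by apply: ub_le_sup; [exists (I 0%N).2 | exists k].
have hi k : sup E <= (I k).2 by apply: ge_sup.
exists (sup E).
  by have := lo 0%N; have := hi 0%N; rewrite /= => *; apply/andP; split; lra.
move=> k ek; have [_ _ _] := stepP _ (f k) (lt k); apply.
by rewrite ek; have := lo k.+1; have := hi k.+1; rewrite /= ek => -> ->.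
Qed.

(** Once the earlier entries of [c] are fixed, an integer vector with last nonzero entry at k rules
    out a single value of c_k, and there are countably many such vectors, enumerated by [pickle]. *)
Lemma exists_generic n (c1 : 'rV[RR]_n) (e : RR) : 0 < e ->
  exists2 c : 'rV[RR]_n, forall j, `|c 0 j - c1 0 j| < e &
    forall u : 'cV[int]_n, u <> 0 -> cost c u <> 0.
Proof.
move=> e0.
suff main k : (k <= n)%N -> exists2 c : 'rV[RR]_n, forall j, `|c 0 j - c1 0 j| < e &
    forall u : 'cV[int]_n, (forall j : 'I_n, (k <= j)%N -> u j 0 = 0) ->
      u <> 0 -> cost c u <> 0.
  have [c h1 h2] := main n (leqnn n); exists c => // u; apply: h2 => j.
  by rewrite leqNgt ltn_ord.
elim: k => [_|k IH kn].
  exists c1 => [j|u hu nz]; first by rewrite subrr normr0.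
  by case: nz; apply/colP => j; rewrite hu // mxE.
have [c cc hc] := IH (ltnW kn); pose o := Ordinal kn.
pose rest (u : 'cV[int]_n) := \sum_(j | j != o) c 0 j * (u j 0)%:~R.
pose f m := if unpickle m is Some u then - rest u / (u o 0)%:~R else 0.
have [|z /andP[z1 z2] hz] := avoid_sequence f (a := c1 0 o - e) (b := c1 0 o + e).
  lra.
exists (\row_j if j == o then z else c 0 j) => [j|u hu nz].
  rewrite mxE; case: eqP => [->|_]; last exact: cc.
  by rewrite ltr_distl z1 z2.
have costz : cost (\row_j if j == o then z else c 0 j) u = z * (u o 0)%:~R + rest u.
  rewrite costE (bigD1 o) //= mxE eqxx; congr (_ + _).
  by apply: eq_bigr => j /negbTE jo; rewrite mxE jo.
rewrite costz; have [uo|uo] := eqVneq (u o 0) 0.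
  have -> : z * (u o 0)%:~R + rest u = cost c u.
    by rewrite costE (bigD1 o) //= uo !mulr0.
  apply: hc => // j; rewrite leq_eqVlt => /orP[/eqP kj|]; last exact: hu.
  by have -> : j = o by apply: val_inj.
move=> /eqP; rewrite addr_eq0 => /eqP ez; apply: (hz (pickle u)).
by rewrite /f pickleK -ez mulfK // intr_eq0.
Qed.

Section Gomory.
Variables (d n : nat) (A : 'M[int]_(d, n)).
Implicit Types (c : 'rV[RR]_n) (y : 'rV[RR]_d) (sigma tau : {set 'I_n}).
Local Notation a j := (col j (Ar A)).

Definition rcost c (M : 'M[RR]_(n, d)) j : RR := c 0 j - pairing A (c *m M) j.

(** The coefficients of the entries of [c] do not involve [c]; this controls reduced costs under
    perturbation. *)
Lemma rcostE c M j :
  rcost c M j = \sum_i c 0 i * ((i == j)%:R - (M *m a j) i 0).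
Proof.
under eq_bigr do rewrite mulrBr; rewrite sumrB /rcost /pairing -mulmxA [in LHS]mxE.
congr (_ - _); rewrite (bigD1 j) //= eqxx mulr1 big1 ?addr0 // => i /negbTE ->.
by rewrite mulr0.
Qed.

Lemma floor_frac (x : RR) : 0 <= x - (Num.floor x)%:~R < 1.
Proof.
have := real_floor_itv (num_real x); rewrite rmorphD /= => /andP[h1 h2].
by rewrite subr_ge0 h1 ltrBlDl.
Qed.

(* On columns inside the cell, c1 is [e] times the sum of the coordinates in the
   basis A_sigma, so a G^sigma-feasible x which uses such columns only costs
   [e * \sum_i (beta_i - x_i)], where beta are the coordinates of b and
   x_i <= floor beta_i: making some x_i negative raises the cost by at least [e].
   All this survives a relative perturbation of the reduced costs by [eta]. *)
Lemma cell_solves c c1 sigma M (e eta : RR) (b : 'cV[int]_d) :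
  inverse_on A sigma M -> 0 < e -> eta * (2 * n%:R + 2) = 1 ->
  (forall j, j \notin sigma -> cone_of A sigma (a j) ->
     rcost c1 M j = e * \sum_i (M *m a j) i 0) ->
  (forall j, j \notin sigma -> ~ cone_of A sigma (a j) ->
     e * (n%:R + 1) <= rcost c1 M j) ->
  (forall j, j \notin sigma -> 0 < rcost c1 M j) ->
  (forall j, j \notin sigma -> `|rcost c M j - rcost c1 M j| <= eta * rcost c1 M j) ->
  hilbert_basis_cols A (fun j => cone_of A sigma (a j)) (cone_of A sigma) ->
  cone_of A sigma (intcv b) ->
  exists x, optG A c sigma (c *m M) b x /\ nonneg_vec x.
Proof.
move=> hM e0 etaE h_in h_out r1_gt0 close [_ hilb] hb.
have n0 : 0 <= n%:R :> RR by rewrite ler0n.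
have eta0 : 0 < eta.
  by rewrite -(pmulr_lgt0 _ (_ : 0 < 2 * n%:R + 2)) ?etaE // ; lra.
have r_lo j : j \notin sigma -> (1 - eta) * rcost c1 M j <= rcost c M j.
  by move=> hj; have := close j hj; rewrite ler_distl => /andP[h _]; lra.
have r_hi j : j \notin sigma -> rcost c M j <= (1 + eta) * rcost c1 M j.
  by move=> hj; have := close j hj; rewrite ler_distl => /andP[_ h]; lra.
have eta1 : eta <= 2^-1 by nra.
have r_gt0 j : j \notin sigma -> 0 < rcost c M j.
  move=> hj; apply: lt_le_trans (r_lo j hj); apply: mulr_gt0; [lra|exact: r1_gt0].
pose be i := (M *m intcv b) i 0.
have be0 i : 0 <= be i by move: i; apply: (coneP hM _).1.
pose fl i : int := Num.floor (be i).
have flout i : i \notin sigma -> fl i = 0.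
  by move=> hi; rewrite /fl /be (inv_out hM) // floor0.
(* In the basis A_sigma, the columns off [sigma] contribute to the i-th coordinate of A x all of it
   except x_i. *)
have coords (x : 'cV[int]_n) i : \sum_(j | j \notin sigma) (x j 0)%:~R * (M *m a j) i 0 =
    (M *m intcv (A *m x)) i 0 - (if i \in sigma then (x i 0)%:~R else 0).
  have -> : M *m intcv (A *m x) = \sum_j (x j 0)%:~R *: (M *m a j).
    rewrite /intcv map_mxM; transitivity (M *m comb A (fun j => (x j 0)%:~R)).
      by rewrite combE; congr (_ *m (_ *m _)); apply/colP => j; rewrite !mxE.
    by rewrite mulmx_sumr; apply: eq_bigr => j _; rewrite scalemxAr.
  rewrite summxE [in RHS](bigID (fun j => j \in sigma)) /= [X in _ = X + _ - _]big_mkcond.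
  have -> : \sum_j (if j \in sigma then ((x j 0)%:~R *: (M *m a j)) i 0 else 0) =
      if i \in sigma then (x i 0)%:~R else 0.
    rewrite (bigD1 i) //= big1 ?addr0 => [|j ji].
      by case: ifP => // hi; rewrite mxE (inv_col hM) // mxE !eqxx mulr1.
    by case: ifP => // hj; rewrite mxE (inv_col hM) // mxE eq_sym (negbTE ji) mulr0.
  rewrite addrAC subrr add0r; apply: eq_bigr => j _; by rewrite [in RHS]mxE.
pose g1 (x : 'cV[int]_n) := \sum_(j | j \notin sigma) rcost c1 M j * (x j 0)%:~R.
have g1E (x : 'cV[int]_n) b' : A *m x = b' ->
    (forall j, j \notin sigma -> x j 0 != 0 -> cone_of A sigma (a j)) ->
    g1 x = e * \sum_i ((M *m intcv b') i 0 - (if i \in sigma then (x i 0)%:~R else 0)).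
  move=> <- hx; under [in RHS]eq_bigr do rewrite -coords.
  rewrite exchange_big mulr_sumr; apply: eq_bigr => j hj.
  have [->|x0] := eqVneq (x j 0) 0.
    by rewrite mulr0 big1 ?mulr0 // => i _; rewrite mul0r.
  by rewrite (h_in _ hj (hx _ hj x0)) -mulr_sumr /=; ring.
pose nf : 'cV[int]_n := \col_i fl i.
have Mnf : M *m intcv (A *m nf) = \col_i (fl i)%:~R.
  apply/colP => i; have := coords nf i; rewrite big1 => [|j hj]; last first.
    by rewrite mxE flout // mul0r.
  move/esym/eqP; rewrite subr_eq0 => /eqP ->; rewrite !mxE.
  by case: ifP => // /negbT /flout ->.
have Mh : M *m intcv (b - A *m nf) = \col_i (be i - (fl i)%:~R).
  rewrite /intcv map_mxB mulmxBr Mnf; apply/colP => i.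
  by rewrite [RHS]mxE [LHS]mxE; congr (_ + _); rewrite mxE [in LHS]mxE.
(* Delta-normality enters here, for the fractional part of [b]. Together with the floors, [z] gives
   a nonnegative competitor of unperturbed cost [e * S]. *)
have [|z [z0 [zsup Az]]] := hilb (b - A *m nf).
  by apply/(coneP hM) => i; rewrite Mh mxE; have /andP[] := floor_frac (be i).
have zin j : j \notin sigma -> z j 0 != 0 -> cone_of A sigma (a j).
  by move=> _ /eqP nz; apply: NNPP => nc; apply: nz; apply: zsup.
have inside_ge0 (x : 'cV[int]_n) :
    (forall j, j \notin sigma -> 0 <= x j 0) ->
    (forall j, j \notin sigma -> x j 0 != 0 -> cone_of A sigma (a j)) ->
    forall i, i \in sigma -> (x i 0)%:~R <= (M *m intcv (A *m x)) i 0.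
  move=> px hx i hi; rewrite -subr_ge0; have := coords x i; rewrite hi => <-.
  apply: sumr_ge0 => j hj; have [->|x0] := eqVneq (x j 0) 0; first by rewrite mul0r.
  by rewrite mulr_ge0 ?ler0z ?px // ((coneP hM _).1 (hx j hj x0)).
(* A generator used in [z] would push a fractional coordinate up to at least 1. *)
have zs i : i \in sigma -> z i 0 = 0.
  move=> hi; have := inside_ge0 z (fun j _ => z0 j) zin i hi.
  rewrite Az Mh mxE => h; have /andP[_ h2] := floor_frac (be i).
  have := le_lt_trans h h2; rewrite -[1]/(1%:~R) ltr_int.
  by have := z0 i; lia.
pose S := \sum_i (be i - (fl i)%:~R).
have S0 : 0 <= S by apply: sumr_ge0 => i _; have /andP[] := floor_frac (be i).
have Sn : S <= n%:R.
  rewrite -[n in n%:R]card_ord -sum1_card natr_sum; apply: ler_sum => i _.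
  by have /andP[_ /ltW] := floor_frac (be i).
have g1z : g1 z = e * S.
  rewrite (g1E z _ Az zin); congr (_ * _); apply: eq_bigr => i _.
  by rewrite Mh mxE; case: ifP => [/zs ->|]; rewrite subr0.
have Ax0 : A *m (nf + z) = b by rewrite mulmxDr Az addrC subrK.
have f0 : feasG A sigma b (nf + z).
  by split=> // j hj; rewrite !mxE flout // add0r z0.
have hc j : j \notin sigma -> pairing A (c *m M) j < c 0 j.
  by move/r_gt0; rewrite subr_gt0.
have [x [fx ox]] := optG_exists hc f0; exists x.
have gE (x' : 'cV[int]_n) : gcost A c sigma (c *m M) x' =
  \sum_(j | j \notin sigma) rcost c M j * (x' j 0)%:~R by [].
have le0 : gcost A c sigma (c *m M) x <= (1 + eta) * (e * S).
  apply: le_trans (ox _ f0) _; rewrite gE -g1z mulr_sumr; apply: ler_sum => j hj.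
  rewrite !mxE flout // add0r mulrA ler_wpM2r ?ler0z ?z0 //; exact: r_hi.
have xin j : j \notin sigma -> x j 0 != 0 -> cone_of A sigma (a j).
  move=> hj x0; apply: NNPP => /(h_out _ hj) h1.
  have x1 : 1 <= (x j 0)%:~R :> RR.
    by rewrite -[1]/(1%:~R) ler_int; move: (fx.1 _ hj) x0; clear; lia.
  have h2 : rcost c M j <= gcost A c sigma (c *m M) x.
    rewrite gE (bigD1 j) //=; apply: (@le_trans _ _ (rcost c M j * (x j 0)%:~R)).
      by rewrite ler_peMr // ltW // r_gt0.
    rewrite lerDl; apply: sumr_ge0 => i /andP[hi _].
    by rewrite mulr_ge0 ?ler0z ?fx.1 // ltW // r_gt0.
  have h3 := r_lo j hj.
  have h4 : (1 - eta) * (e * (n%:R + 1)) <= (1 - eta) * rcost c1 M j.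
    by apply: ler_wpM2l => //; lra.
  (* With S <= n this yields 1 <= (2n+1) eta, against (2n+2) eta = 1. The final contradiction, from
     (1 - eta)(S+1) <= (1 + eta) S, is the same one; both constants are fitted to it. *)
  have : e * ((1 - eta) * (n%:R + 1)) <= e * ((1 + eta) * S) by lra.
  rewrite ler_pM2l // => h5.
  have : (1 + eta) * S <= (1 + eta) * n%:R by apply: ler_wpM2l => //; lra.
  lra.
have lo : (1 - eta) * g1 x <= gcost A c sigma (c *m M) x.
  rewrite gE mulr_sumr; apply: ler_sum => j hj.
  rewrite mulrA; apply: ler_wpM2r; first by rewrite ler0z fx.1.
  exact: r_lo.
have xfl i : i \in sigma -> x i 0 <= fl i.
  move=> hi; have := inside_ge0 x fx.1 xin i hi; rewrite fx.2 => h.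
  by rewrite /fl real_floor_ge_int ?num_real.
split=> // i; have [hi|hi] := boolP (i \in sigma); last exact: fx.1.
rewrite leNgt; apply/negP => xi0.
have gap : S + 1 <= \sum_i (be i - (if i \in sigma then (x i 0)%:~R else 0)).
  rewrite /S (bigD1 i) //= [leRHS](bigD1 i) //= hi addrAC; apply: lerD.
    suff : (x i 0)%:~R + 1 <= (fl i)%:~R :> RR by lra.
    rewrite -[1]/(1%:~R) -intrD ler_int.
    have : 0 <= fl i by rewrite /fl real_floor_ge0 ?num_real ?be0.
    by move: xi0; clear; lia.
  apply: ler_sum => k _; rewrite lerD2l lerN2; case: ifP => [/xfl|/negbT/flout ->].
    by rewrite ler_int.
  by rewrite mulr0z.
have g1x := g1E x b fx.2 xin.
have : e * ((1 - eta) * (S + 1)) <= e * ((1 + eta) * S).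
  have : (1 - eta) * (e * (S + 1)) <= (1 - eta) * g1 x.
    by rewrite g1x; apply: ler_wpM2l; [lra|rewrite ler_pM2l].
  lra.
rewrite ler_pM2l // => h5.
have : eta * S <= eta * n%:R by rewrite ler_pM2l.
lra.
Qed.

End Gomory.

Lemma costB n (c : 'rV[RR]_n) x x' : cost c (x - x') = cost c x - cost c x'.
Proof. by rewrite /cost /intcv map_mxB mulmxBr !mxE. Qed.

(** * From Delta-normality to a Gomory family *)

Section Gomory.
Variables (d n : nat) (A : 'M[int]_(d, n)).
Implicit Types (c : 'rV[RR]_n) (y : 'rV[RR]_d) (sigma tau : {set 'I_n}).
Local Notation a j := (col j (Ar A)).

Lemma cone_setT (l : 'I_n -> RR) : (forall j, 0 <= l j) -> cone_of A setT (comb A l).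
Proof. by move=> h; apply/cone_comb; exists l; split=> // j; rewrite inE. Qed.

Lemma comb_delta (j : 'I_n) : comb A (fun i => (i == j)%:R) = a j.
Proof.
rewrite /comb (bigD1 j) //= eqxx scale1r big1 ?addr0 // => i /negbTE ->.
by rewrite scale0r.
Qed.

Lemma cone_sub sigma tau v : sigma \subset tau -> cone_of A sigma v -> cone_of A tau v.
Proof.
move=> st /cone_comb[l [l0 ls ->]]; apply/cone_comb; exists l; split=> // j hj.
by apply: ls; apply: contra hj; apply: (subsetP st).
Qed.

Lemma cone_max_face (D : {set 'I_n} -> Prop) v : is_triangulation A D ->
  cone_of A setT v -> exists sigma, max_face D sigma /\ cone_of A sigma v.
Proof.
move=> [_ _ cov _] /cov[sigma [hs hv]].
have [tau [mt st]] := exists_max_face hs.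
by exists tau; split=> //; apply: cone_sub hv.
Qed.

(** Moving the witness a little against the functional that is 1 on the columns of [sigma] outside
    [tau] and 0 on those of [tau] loosens exactly the former; a small step preserves the strict
    inequalities off [sigma]. *)
Lemma Delta_face c sigma tau M : dual_basis A sigma M ->
  Delta A c sigma -> tau \subset sigma -> Delta A c tau.
Proof.
move=> [_ dM] [y hy] ts; have {}hy : witness A c sigma y := hy.
pose z : 'rV[RR]_d := (\row_i (i \in sigma :\: tau)%:R) *m M.
have hz i : i \in sigma -> pairing A z i = (i \notin tau)%:R.
  move=> hi; rewrite /pairing -mulmxA.
  have -> : M *m a i = delta_mx i 0.
    by apply/colP => k; rewrite (dM _ _ hi) mxE eqxx andbT.
  by rewrite -colE !mxE inE hi andbT.
have [|s s0 hs] := @pos_uniform 'I_n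
    (fun j s => j \notin sigma -> pairing A y j - s * pairing A z j < c 0 j).
  move=> j; have [hj|hj] := boolP (j \in sigma); first by exists 1.
  have g0 : 0 < c 0 j - pairing A y j by rewrite subr_gt0; exact: (hy j).2.
  exists ((c 0 j - pairing A y j) / (1 + `|pairing A z j|)).
    by rewrite divr_gt0 // ltr_pwDl.
  move=> s /andP[s0]; rewrite ler_pdivlMr ?ltr_pwDl // => hs _.
  have : - (s * pairing A z j) <= s * `|pairing A z j|.
    by rewrite -mulrN ler_pM2l // -normrN ler_norm.
  by rewrite mulrDr mulr1 in hs; lra.
exists (y + (- s) *: z) => j; rewrite -/(pairing A _ j) pairD pairZ mulNr.
split=> hj.
  by have js := subsetP ts _ hj; rewrite hz // hj /= mulr0 subr0 ((hy j).1 js).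
have [js|js] := boolP (j \in sigma); last exact: hs.
by rewrite hz // hj mulr1 ((hy j).1 js); lra.
Qed.

(** Positive reduced costs put every cell of [c0] into the new subdivision. These cells already
    cover the cone, so [Delta_sub] places every face of the new one inside an old cell. *)
Lemma Delta_eq c0 c (M : {set 'I_n} -> 'M[RR]_(n, d)) :
  is_triangulation A (Delta A c0) ->
  (forall sigma, max_face (Delta A c0) sigma -> inverse_on A sigma (M sigma)) ->
  (forall sigma j, max_face (Delta A c0) sigma -> j \notin sigma ->
     0 < rcost A c (M sigma) j) ->
  Delta A c0 = Delta A c.
Proof.
move=> tri hM hr.
have sub sigma : max_face (Delta A c0) sigma -> Delta A c sigma.
  move=> ms; exists (c *m M sigma) => j; rewrite -/(pairing A _ j); split=> hj.
    by rewrite (inv_pair (hM _ ms)).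
  by rewrite -subr_gt0; apply: hr.
apply: funext => tau; apply: propext; split=> [ht|ht].
  have [sigma [ms ts]] := exists_max_face ht.
  exact: Delta_face (hM _ ms).1 (sub _ ms) ts.
have [sigma [ms hc]] := cone_max_face tri (cone_setT (l := fun j => (j \in tau)%:R)
  (fun j => ler0n _ _)).
by have [down _ _ _] := tri; apply: down ms.1 (Delta_sub (sub _ ms) ht hc).
Qed.

Lemma Delta_normal_supports c0 : \rank (Ar A) = d -> (forall j, a j <> 0) ->
  is_triangulation A (Delta A c0) -> Delta_normal A (Delta A c0) ->
  exists c, supports A (Delta A c0) c.
Proof.
move=> rk nz tri dn; have [down ind cov _] := tri; pose D := Delta A c0.
(* [L j] writes a_j by the generators of one cell. By [Lin] its support lies in every cell
   containing a_j, so [f] and [g] below do not depend on that choice. *)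
have /boolp.choice[L hL] : forall j, exists l : 'I_n -> RR, exists sigma,
    [/\ D sigma, forall i, 0 <= l i, forall i, i \notin sigma -> l i = 0 & a j = comb A l].
  move=> j; have : cone_of A setT (a j).
    by rewrite -comb_delta; apply: cone_setT => i; apply: ler0n.
  move=> /cov[sigma [hs /cone_comb[l [l0 ls lE]]]]; by exists l, sigma.
have L0 j i : 0 <= L j i by have [? []] := hL j.
have LE j : a j = comb A (L j) by have [? []] := hL j.
have Lin sigma j : D sigma -> cone_of A sigma (a j) ->
    forall i, i \notin sigma -> L j i = 0.
  move=> hs /cone_comb[l [l0 ls lE]]; have [tau [ht _ Lt _]] := hL j.
  by move=> i; apply: (Delta_support hs ht ls l0 Lt (L0 j)); rewrite -lE LE.
have LV j : D [set j] -> forall i, L j i = (i == j)%:R.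
  move=> hj; have out i : i \notin [set j] -> L j i = 0.
    move=> hi; apply: (Lin _ _ hj _ _ hi); rewrite -comb_delta; apply/cone_comb.
    exists (fun i => (i == j)%:R); split=> // k.
    by rewrite inE => /negbTE ->.
  move=> i; apply/eqP; rewrite -subr_eq0; apply/eqP.
  apply: (ind _ hj (fun i => L j i - (i == j)%:R)) => [k hk|].
    by rewrite out //; move: hk; rewrite inE => /negbTE ->; rewrite subr0.
  under eq_bigr do rewrite scalerBl.
  by rewrite sumrB -/(comb A _) -/(comb A (fun k => (k == j)%:R)) -LE comb_delta subrr.
have /boolp.choice[M hM] : forall sigma, exists M : 'M[RR]_(n, d),
    max_face D sigma -> inverse_on A sigma M.
  move=> sigma; case: (classic (max_face D sigma)) => [ms|nm]; last by exists 0 => /nm.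
  by have [M hM] := max_face_inverse rk tri ms; exists M.
pose f j := \sum_i L j i * c0 0 i; pose g j := \sum_i L j i.
pose V j := `[< D [set j] >].
pose c1 (e : RR) : 'rV[RR]_n := \row_j (f j + (if V j then 0 else e * g j)).
have face1 sigma i : D sigma -> i \in sigma -> D [set i].
  by move=> hs hi; apply: down hs _; rewrite sub1set.
have c1V e sigma i : D sigma -> i \in sigma -> c1 e 0 i = c0 0 i.
  move=> hs hi; have hi1 := face1 _ _ hs hi.
  rewrite mxE /V; have -> : `[< D [set i] >] by apply/asboolP.
  rewrite addr0 /f (bigD1 i) //= LV // eqxx mul1r big1 ?addr0 // => k /negbTE ki.
  by rewrite LV // ki mul0r.
have wit sigma : max_face D sigma -> witness A c0 sigma (c0 *m M sigma).
  move=> ms; case: (ms.1) => y hy.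
  by rewrite -(inv_pairE (hM _ ms) (y := y)) // => i hi; apply: (hy i).1.
have c1M e sigma : max_face D sigma -> c1 e *m M sigma = c0 *m M sigma.
  move=> ms; apply/esym/(inv_pairE (hM _ ms)) => i hi.
  by rewrite (inv_pair (hM _ ms)) // (c1V _ _ _ ms.1).
(* How far [f] rises at a_j above the linear function of [sigma]: for a maximal face this is 0 if
   a_j lies in the cell and positive otherwise, by [gap_in] and [gap_out]. *)
pose gap sigma j := f j - pairing A (c0 *m M sigma) j.
have rc1 e sigma j : max_face D sigma ->
    rcost A (c1 e) (M sigma) j = gap sigma j + (if V j then 0 else e * g j).
  by move=> ms; rewrite /rcost c1M // mxE /gap; lra.
have gapE sigma j : gap sigma j = \sum_i L j i * (c0 0 i - pairing A (c0 *m M sigma) i).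
  rewrite /gap {1}/pairing LE mul_comb /f -sumrB; apply: eq_bigr => i _.
  by rewrite mulrBr.
have slack sigma i : max_face D sigma -> 0 <= c0 0 i - pairing A (c0 *m M sigma) i.
  move=> ms; rewrite subr_ge0; have [hi|hi] := boolP (i \in sigma).
    by rewrite ((wit _ ms i).1 hi).
  by apply: ltW; apply: (wit _ ms i).2.
have gap0 sigma j : max_face D sigma -> 0 <= gap sigma j.
  by move=> ms; rewrite gapE; apply: sumr_ge0 => i _; apply: mulr_ge0 => //; apply: slack.
have gap_in sigma j : max_face D sigma -> cone_of A sigma (a j) -> gap sigma j = 0.
  move=> ms hj; rewrite gapE big1 // => i _; have [hi|hi] := boolP (i \in sigma).
    by rewrite ((wit _ ms i).1 hi) subrr mulr0.
  by rewrite (Lin _ _ ms.1 hj) ?mul0r.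
have gap_out sigma j : max_face D sigma -> ~ cone_of A sigma (a j) -> 0 < gap sigma j.
  move=> ms hj; rewrite lt_neqAle gap0 // andbT eq_sym; apply/negP.
  rewrite gapE psumr_eq0 => [/allP h|i _]; last by apply: mulr_ge0 => //; apply: slack.
  apply: hj; apply/cone_comb; exists (L j); split=> // i hi.
  have := h i (mem_index_enum i); rewrite /= mulf_eq0 => /orP[/eqP //|].
  by rewrite subr_eq0 => /eqP e; have := (wit _ ms i).2 hi; rewrite -e ltxx.
have g0 j : 0 < g j.
  rewrite lt_neqAle sumr_ge0 // andbT eq_sym; apply/negP.
  rewrite psumr_eq0 // => /allP h; apply: (nz j); rewrite LE /comb big1 // => i _.
  by have /eqP -> := h i (mem_index_enum i); rewrite scale0r.
have V_in sigma j : D sigma -> V j -> cone_of A sigma (a j) -> j \in sigma.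
  move=> hs /asboolP hj hc; apply/negPn/negP => /(Lin _ _ hs hc).
  by rewrite LV // eqxx => /eqP; rewrite oner_eq0.
have [|e e0 he] := @pos_uniform ({set 'I_n} * 'I_n)%type
    (fun p e => max_face D p.1 -> ~ cone_of A p.1 (a p.2) ->
       e * (n%:R + 1) <= gap p.1 p.2).
  move=> [sigma j] /=; case: (classic (max_face D sigma /\ ~ cone_of A sigma (a j))).
    move=> [ms hj]; exists (gap sigma j / (n%:R + 1)).
      by rewrite divr_gt0 ?gap_out // ltr_wpDl.
    by move=> e /andP[_]; rewrite ler_pdivlMr // ltr_wpDl.
  by move=> no; exists 1 => // e _ ms hj; case: no.
have r1_in sigma j : max_face D sigma -> j \notin sigma -> cone_of A sigma (a j) ->
    rcost A (c1 e) (M sigma) j = e * \sum_i (M sigma *m a j) i 0.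
  move=> ms hj hc; rewrite rc1 // gap_in // add0r; case: ifP => [Vj|_].
    by rewrite (V_in _ _ ms.1 Vj hc) in hj.
  congr (_ * _); apply: eq_bigr => i _; rewrite LE (inv_comb (hM _ ms)) //.
  exact: (Lin _ _ ms.1 hc).
have r1_out sigma j : max_face D sigma -> j \notin sigma -> ~ cone_of A sigma (a j) ->
    e * (n%:R + 1) <= rcost A (c1 e) (M sigma) j.
  move=> ms hj hc; rewrite rc1 //; apply: le_trans (he (sigma, j) ms hc) _.
  by rewrite /= lerDl; case: ifP => // _; rewrite mulr_ge0 // ltW.
have r1_gt0 sigma j : max_face D sigma -> j \notin sigma ->
    0 < rcost A (c1 e) (M sigma) j.
  move=> ms hj; case: (classic (cone_of A sigma (a j))) => hc.
    rewrite rc1 // gap_in // add0r; case: ifP => [Vj|_]; last exact: mulr_gt0.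
    by rewrite (V_in _ _ ms.1 Vj hc) in hj.
  by apply: lt_le_trans (r1_out _ _ ms hj hc); rewrite mulr_gt0 // ltr_wpDl.
pose eta : RR := (2 * n%:R + 2)^-1.
have n0 : 0 <= n%:R :> RR by rewrite ler0n.
have eta0 : 0 < eta by rewrite invr_gt0; lra.
have etaE : eta * (2 * n%:R + 2) = 1 by rewrite mulVf //; apply: lt0r_neq0; lra.
(* By [rcostE] a reduced cost moves by at most t times the l1-norm of its coefficients; t keeps this
   within the relative error [eta]. *)
have [|t t0 ht] := @pos_uniform ({set 'I_n} * 'I_n)%type
    (fun p t => max_face D p.1 -> p.2 \notin p.1 -> forall c : 'rV[RR]_n,
       (forall i, `|c 0 i - c1 e 0 i| < t) ->
       `|rcost A c (M p.1) p.2 - rcost A (c1 e) (M p.1) p.2|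
         <= eta * rcost A (c1 e) (M p.1) p.2).
  move=> [sigma j] /=; case: (classic (max_face D sigma /\ j \notin sigma)); last first.
    by move=> no; exists 1 => // t _ ms hj; case: no.
  move=> [ms hj]; pose w i := (i == j)%:R - (M sigma *m a j) i 0 : RR.
  have W0 : 0 < 1 + \sum_i `|w i| by rewrite ltr_pwDl // sumr_ge0.
  exists (eta * rcost A (c1 e) (M sigma) j / (1 + \sum_i `|w i|)).
    by rewrite divr_gt0 // mulr_gt0 // r1_gt0.
  move=> t /andP[t0]; rewrite ler_pdivlMr // => ht _ _ c hc; apply: le_trans ht.
  rewrite !rcostE -sumrB; apply: le_trans (ler_norm_sum _ _ _) _.
  apply: (@le_trans _ _ (\sum_i t * `|w i|)).
    by apply: ler_sum => i _; rewrite -mulrBl normrM ler_wpM2r // ltW.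
  by rewrite -mulr_sumr ler_pM2l // lerDr.
have [c cc hgen] := exists_generic (c1 e) t0.
have cl sigma j : max_face D sigma -> j \notin sigma ->
    `|rcost A c (M sigma) j - rcost A (c1 e) (M sigma) j|
      <= eta * rcost A (c1 e) (M sigma) j.
  by move=> ms hj; exact: (ht (sigma, j)).
have r_gt0 sigma j : max_face D sigma -> j \notin sigma -> 0 < rcost A c (M sigma) j.
  move=> ms hj; have := cl _ _ ms hj; rewrite ler_distl => /andP[h _].
  have r1 := r1_gt0 _ _ ms hj; have e2 : eta <= 2^-1 by clear -n0 eta0 etaE; nra.
  have : eta * rcost A (c1 e) (M sigma) j <= 2^-1 * rcost A (c1 e) (M sigma) j.
    by rewrite ler_pM2r.
  by clear -h r1; lra.
have DE : Delta A c0 = Delta A c by apply: (Delta_eq tri hM).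
have solve b : inNA A b -> exists sigma x, [/\ max_face (Delta A c) sigma,
    optG A c sigma (c *m M sigma) b x, nonneg_vec x & inverse_on A sigma (M sigma)].
  case=> u [u0 <-]; have : cone_of A setT (intcv (A *m u)).
    have -> : intcv (A *m u) = comb A (fun j => (u j 0)%:~R).
      by rewrite /intcv map_mxM combE; congr (_ *m _); apply/colP => j; rewrite !mxE.
    by apply: cone_setT => j; rewrite ler0z.
  move=> /(cone_max_face tri)[sigma [ms hb]].
  have [x [ox x0]] := cell_solves (hM _ ms) e0 etaE
    (fun j => r1_in sigma j ms) (fun j => r1_out sigma j ms) (fun j => r1_gt0 sigma j ms)
    (fun j => cl sigma j ms) (dn _ ms) hb.
  by exists sigma, x; split=> //; [rewrite -DE | exact: hM].
exists c; split.
- split=> [|b hb]; first by rewrite -DE.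
  have [sigma [x [ms ox x0 hMs]]] := solve _ hb.
  have oi : optIP A c b x.
    by apply: optG_optIP ox x0 => j hj; exact: (inv_pair hMs).
  exists x; split=> // x' ox'; apply: NNPP => ne.
  apply: (hgen (x - x')) => [e'|]; first by apply: ne; apply: subr0_eq.
  apply/eqP; rewrite costB subr_eq0 eq_le.
  by rewrite (oi.2 _ ox'.1) (ox'.2 _ oi.1).
- by move=> sigma; rewrite DE.
- move=> b hb; have [sigma [x [ms ox x0 hMs]]] := solve _ hb.
  exists sigma; split=> // y hy; have -> : y = c *m M sigma := inv_pairE hMs hy.
  by exists x.
Qed.

End Gomory.

(** * Star subdivision by inner columns *)

Section Select.
Variables (R : pzSemiRingType) (n d : nat) (s : 'I_d -> 'I_n).

Definition select_mx : 'M[R]_(n, d) := \matrix_(j, k) (s k == j)%:R.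

Lemma mul_select_mx m (B : 'M[R]_(m, n)) : B *m select_mx = colsub s B.
Proof.
apply/matrixP => i k; rewrite !mxE (bigD1 (s k)) //= mxE eqxx mulr1.
by rewrite big1 ?addr0 // => j /negbTE jk; rewrite mxE eq_sym jk mulr0.
Qed.

Lemma select_mxE (v : 'cV[R]_d) j : (select_mx *m v) j 0 = \sum_(k | s k == j) v k 0.
Proof.
rewrite mxE [in RHS]big_mkcond; apply: eq_bigr => k _.
by rewrite mxE; case: ifP; rewrite ?mul1r ?mul0r.
Qed.

End Select.

Definition set_col_mx (R : pzSemiRingType) d (i : 'I_d) (v : 'cV[R]_d) : 'M_d :=
  \matrix_(k, l) if l == i then v k 0 else (k == l)%:R.

(** The cofactors along column [i] are those of the identity, read off from its adjugate. *)
Lemma det_set_col_mx (R : comPzRingType) d (i : 'I_d) (v : 'cV[R]_d) :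
  \det (set_col_mx i v) = v i 0.
Proof.
have cof k : cofactor (set_col_mx i v) k i = (i == k)%:R.
  transitivity ((\adj (1%:M : 'M[R]_d)) i k); last first.
    by rewrite -[\adj _]mulmx1 mul_adj_mx det1 mxE.
  rewrite [in RHS]mxE /cofactor; congr (_ * \det _); apply/matrixP => x y.
  by rewrite !mxE eq_sym (negbTE (neq_lift i y)).
rewrite (expand_det_col _ i) (bigD1 i) //= cof eqxx mulr1 mxE eqxx.
by rewrite big1 ?addr0 // => k /negbTE ki; rewrite cof eq_sym ki mulr0.
Qed.

Local Notation realmx := (map_mx (fun z : int => z%:~R : RR)).

(** An integral inverse would make the determinant a unit, so some column of the inverse has a
    non-integral entry. Its fractional part is [al]. *)
Lemma fractional_point d (B : 'M[int]_d) : 1 < `|\det B| ->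
  exists (h : 'cV[int]_d) (al : 'cV[RR]_d),
    [/\ intcv h = realmx B *m al, forall k, 0 <= al k 0 < 1 & al <> 0].
Proof.
move=> hB; have dB : \det (realmx B) = (\det B)%:~R by rewrite det_map_mx.
have uB : realmx B \in unitmx.
  by rewrite unitmxE dB unitfE intr_eq0 -normr_gt0 (lt_trans ltr01).
pose C := invmx (realmx B).
have [k [l nint]] : exists k l, (Num.floor (C k l))%:~R <> C k l.
  apply: NNPP => no; pose C' := map_mx Num.floor C.
  have eC : realmx C' = C.
    apply/matrixP => k l; rewrite !mxE; apply: NNPP => ne; apply: no; by exists k, l.
  have : (\det B * \det C')%:~R = 1 :> RR.
    by rewrite rmorphM /= -!(det_map_mx intr) /= -det_mulmx eC mulmxV // det1.
  move=> /eqP; rewrite -[1]/(1%:~R) eqr_int => /eqP e.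
  have C0 : \det C' <> 0 by move=> h0; move: e; rewrite h0 mulr0.
  have := congr1 (fun z => `|z|) e; rewrite normrM normr1.
  have : 0 < `|\det C'|.
    by rewrite normr_gt0; apply/eqP.
  by move: hB; clear; move: (`|_|) (`|_|); nia.
pose b : 'cV[int]_d := delta_mx l 0.
have [be [Bbe beE]] : exists be, realmx B *m be = intcv b /\ forall i, be i 0 = C i l.
  exists (col l C); split=> [|i]; last by rewrite mxE.
  rewrite -col_mul mulmxV //; apply/colP => i; rewrite !mxE andbT.
  by case: (_ == _).
pose fl : 'cV[int]_d := \col_i Num.floor (be i 0).
exists (b - B *m fl), (be - intcv fl); split.
- by rewrite /intcv map_mxB map_mxM mulmxBr Bbe.
- by move=> i; rewrite !mxE; apply: floor_frac.
- move/colP/(_ k); rewrite !mxE => /eqP; rewrite subr_eq0 => /eqP.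
  by rewrite beE => /esym.
Qed.

Section Criterion.
Variables (d n : nat) (A : 'M[int]_(d, n)).
Local Notation a j := (col j (Ar A)).
Implicit Types (s : 'I_d -> 'I_n).

(** Coordinates below 1 make the determinants drop in the star subdivision at [m]. All d-tuples of
    columns are allowed, since the recursion leaves the cells of the given triangulation. *)
Definition inner_columns : Prop := forall s, 1 < `|\det (colsub s A)| ->
  exists m (al : 'cV[RR]_d), a m = colsub s (Ar A) *m al /\ forall k, 0 <= al k 0 < 1.

Lemma det_colsub s : \det (colsub s (Ar A)) = (\det (colsub s A))%:~R.
Proof. by rewrite -det_map_mx; congr (\det _); apply/matrixP => i j; rewrite !mxE. Qed.

Hypothesis inner : inner_columns.
Hypothesis nz : forall j, a j <> 0.

(* Replacing the generator s i by an inner column m multiplies the determinant by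
   the coordinate [al i < 1]; the minimal ratio [be i / al i] selects the cone of
   the star subdivision at m which contains b. *)
Lemma subcone_generated N s (b : 'cV[int]_d) (be : 'cV[RR]_d) :
  (`|\det (colsub s A)| < N)%N -> \det (colsub s A) != 0 ->
  intcv b = colsub s (Ar A) *m be -> (forall k, 0 <= be k 0) ->
  exists u : 'cV[int]_n, [/\ nonneg_vec u, A *m u = b &
    forall j, u j 0 != 0 -> exists ga : 'cV[RR]_d,
      a j = colsub s (Ar A) *m ga /\ forall k, 0 <= ga k 0].
Proof.
elim: N s b be => // N IH s b be hN d0 eb be0.
have uR : colsub s (Ar A) \in unitmx by rewrite unitmxE det_colsub unitfE intr_eq0.
have [d1|d1] := ltP 1 `|\det (colsub s A)|; last first.
  have uZ : colsub s A \in unitmx.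
    by rewrite unitmxE; move: d0 d1; move: (\det _) => z; clear => z0 z1; have : (z == 1) || (z == -1) by lia.
  pose b' := invmx (colsub s A) *m b.
  have Eb : b = colsub s A *m b' by rewrite mulmxA mulmxV // mul1mx.
  have eb' : intcv b' = be.
    have : colsub s (Ar A) *m intcv b' = colsub s (Ar A) *m be.
      rewrite -eb [in RHS]Eb /intcv [in RHS]map_mxM; congr (_ *m _).
      by apply/matrixP => i j; rewrite !mxE.
    by move/(congr1 (mulmx (invmx (colsub s (Ar A))))); rewrite !mulKmx.
  have b'0 k : 0 <= b' k 0.
    by have := be0 k; rewrite -eb' mxE ler0z.
  exists (select_mx _ s *m b'); split.
  - by move=> j; rewrite select_mxE sumr_ge0.
  - by rewrite mulmxA mul_select_mx.
  - move=> j; rewrite select_mxE => h; have [k sk] : exists k, s k = j.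
      apply: NNPP => no; move/eqP: h; apply; rewrite big1 // => k /eqP sk.
      by case: no; exists k.
    exists (delta_mx k 0); split; last by move=> i; rewrite mxE ler0n.
    by rewrite -colE; apply/colP => i; rewrite !mxE sk.
have [m [al [em al01]]] := inner d1.
have [i0 hi0] : exists i, 0 < al i 0.
  apply: NNPP => no; apply: (nz (j := m)); rewrite em.
  suff -> : al = 0 by rewrite mulmx0.
  apply/colP => k; rewrite mxE; apply/eqP; rewrite eq_le (proj1 (andP (al01 k))) andbT.
  by rewrite leNgt; apply/negP => h; apply: no; exists k.
case: (@arg_minP _ _ _ i0 (fun i => 0 < al i 0) (fun i => be i 0 / al i 0) hi0) => i hi mi.
pose s' k := if k == i then m else s k.
pose E := set_col_mx i al.
have sE : colsub s' (Ar A) = colsub s (Ar A) *m E.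
  apply/matrixP => x l; rewrite !mxE /s'; have [li|li] := eqVneq l i.
    have := congr1 (fun v : 'cV_d => v x 0) em; rewrite !mxE => ->.
    by apply: eq_bigr => k _; rewrite !mxE li eqxx.
  rewrite (bigD1 l) //= !mxE (negbTE li) eqxx mulr1 big1 ?addr0 // => k /negbTE kl.
  by rewrite !mxE (negbTE li) kl mulr0.
have detE : (\det (colsub s' A))%:~R = (\det (colsub s A))%:~R * al i 0 :> RR.
  by rewrite -!det_colsub sE det_mulmx det_set_col_mx.
have al1 : al i 0 < 1 by have /andP[] := al01 i.
have Ege0 (ga : 'cV[RR]_d) : (forall k, 0 <= ga k 0) -> forall k, 0 <= (E *m ga) k 0.
  move=> ga0 k; rewrite mxE sumr_ge0 // => l _; rewrite mulr_ge0 // mxE.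
  by case: ifP => _; [have /andP[] := al01 k | rewrite ler0n].
pose be' : 'cV[RR]_d := \col_k if k == i then be i 0 / al i 0
                            else be k 0 - al k 0 * (be i 0 / al i 0).
have Ebe : E *m be' = be.
  apply/colP => k; rewrite mxE (bigD1 i) //= !mxE eqxx.
  have [->|ki] := eqVneq k i.
    rewrite big1 ?addr0 => [|l /negbTE li]; first by rewrite mulrC divfK // gt_eqF.
    by rewrite !mxE li eq_sym li mul0r.
  rewrite (bigD1 k) //= !mxE (negbTE ki) eqxx mul1r big1 ?addr0 => [|l /andP[/negbTE li /negbTE lk]].
    by rewrite addrC subrK.
  by rewrite !mxE li eq_sym lk mul0r.
have [||||u [u0 Au hu]] := IH s' b be'.
- rewrite -ltnS; apply: leq_trans hN; rewrite ltnS.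
  rewrite -ltz_nat !abszE -(ltr_int RR) !intr_norm detE normrM (gtr0_norm hi).
  by rewrite gtr_pMr // normr_gt0 intr_eq0.
- by rewrite -(intr_eq0 RR) detE mulf_eq0 negb_or intr_eq0 d0 gt_eqF.
- by rewrite sE -mulmxA Ebe.
- move=> k; rewrite mxE; case: ifP => _; first by rewrite divr_ge0 // ltW.
  rewrite subr_ge0; have [hk|hk] := ltP 0 (al k 0).
    by rewrite mulrC -ler_pdivlMr // mi.
  by apply: le_trans (be0 k); rewrite mulr_le0_ge0 // divr_ge0 // (ltW hi).
exists u; split=> // j /hu[ga [ej ga0]]; exists (E *m ga); split; last exact: Ege0.
by rewrite mulmxA -sE.
Qed.

(** Compare traces: A M is the identity, while the diagonal of M A is 1 on [sigma] and 0
    elsewhere. *)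
Lemma card_cell sigma M : inverse_on A sigma M -> #|sigma| = d.
Proof.
move=> hM; apply/eqP; rewrite -(eqr_nat RR); apply/eqP.
have <- : \tr (Ar A *m M) = d%:R by rewrite hM.2 mxtrace1.
rewrite mxtrace_mulC -sum1_card natr_sum big_mkcond; apply: eq_bigr => i _.
have -> : (M *m Ar A) i i = (M *m a i) i 0 by rewrite -col_mul [RHS]mxE.
case: ifP => [hi|/negbT hi]; last by rewrite (inv_out hM).
by rewrite (inv_col hM) // mxE !eqxx.
Qed.

Lemma cell_enum sigma M : inverse_on A sigma M -> exists s : 'I_d -> 'I_n,
  [/\ injective s, forall k, s k \in sigma & colsub s (Ar A) *m rowsub s M = 1%:M].
Proof.
move=> hM; have e := card_cell hM.
exists (fun k => enum_val (cast_ord (esym e) k)); split.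
- by move=> k l /enum_val_inj/cast_ord_inj.
- by move=> k; apply: enum_valP.
rewrite -hM.2; apply/matrixP => i j; rewrite !mxE.
transitivity (\sum_(x in sigma) Ar A i x * M x j); last first.
  rewrite big_mkcond; apply: eq_bigr => x _; case: ifP => // /negbT hx.
  by rewrite (hM.1.1 _ _ hx) mulr0.
rewrite [RHS]big_enum_val [RHS](reindex (cast_ord (esym e))) /=; last first.
  by exists (cast_ord e) => k _; rewrite ?cast_ordK ?cast_ordKV.
by apply: eq_bigr => k _; rewrite !mxE.
Qed.

Lemma inner_columns_Delta_normal c : \rank (Ar A) = d ->
  is_triangulation A (Delta A c) -> Delta_normal A (Delta A c).
Proof.
move=> rk tri sigma ms; have [M hM] := max_face_inverse rk tri ms.
have [s [_ hs sM]] := cell_enum hM; split=> // b hb.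
have [|||u [u0 Au hu]] := @subcone_generated _ s b (rowsub s M *m intcv b) (ltnSn _).
- apply/negP => /eqP d0; have := congr1 determinant sM.
  by rewrite det_mulmx det_colsub d0 mul0r det1 => /esym/eqP; rewrite oner_eq0.
- by rewrite mulmxA sM mul1mx.
- move=> k; have := (coneP hM _).1 hb (s k); congr (0 <= _).
  by rewrite !mxE; apply: eq_bigr => i _; rewrite [in RHS]mxE.
exists u; split=> //; split=> // j nc; apply/eqP/negPn/negP => /hu[ga [ej ga0]].
apply: nc; rewrite ej; apply/cone_comb.
exists (fun x => (select_mx _ s *m ga) x 0); split.
- by move=> x; rewrite select_mxE sumr_ge0.
- move=> x hx; rewrite select_mxE big1 // => k /eqP sk.
  by rewrite -sk hs in hx.
- rewrite combE -mul_select_mx -mulmxA; congr (_ *m _).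
  by apply/colP => x; rewrite [RHS]mxE.
Qed.

End Criterion.

(** * Hilbert bases in low dimension *)

Section Standing.
Variables (d n : nat) (A : 'M[int]_(d, n)).
Local Notation a j := (col j (Ar A)).

Lemma coneD v v' : cone_of A setT v -> cone_of A setT v' -> cone_of A setT (v + v').
Proof.
move=> /cone_comb[l [l0 _ ->]] /cone_comb[l' [l0' _ ->]].
have -> : comb A l + comb A l' = comb A (fun j => l j + l' j).
  by rewrite /comb -big_split; apply: eq_bigr => j _; rewrite scalerDl.
by apply: cone_setT => j; rewrite addr_ge0.
Qed.

Lemma coneZ (t : RR) v : 0 <= t -> cone_of A setT v -> cone_of A setT (t *: v).
Proof.
move=> t0 /cone_comb[l [l0 _ ->]].
have -> : t *: comb A l = comb A (fun j => t * l j).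
  by rewrite /comb scaler_sumr; apply: eq_bigr => j _; rewrite scalerA.
by apply: cone_setT => j; rewrite mulr_ge0.
Qed.

Lemma cone_col j : cone_of A setT (a j).
Proof. by rewrite -comb_delta; apply: cone_setT => i; apply: ler0n. Qed.

Lemma intcv_mul (u : 'cV[int]_n) : intcv (A *m u) = comb A (fun j => (u j 0)%:~R).
Proof.
by rewrite /intcv map_mxM combE; congr (_ *m _); apply/colP => j; rewrite !mxE.
Qed.

Lemma cone_intcv_mul u : nonneg_vec u -> cone_of A setT (intcv (A *m u)).
Proof. by move=> u0; rewrite intcv_mul; apply: cone_setT => j; rewrite ler0z. Qed.

Lemma intcv_inj m : injective (@intcv m).
Proof.
move=> u v /colP e; apply/colP => i; have := e i; rewrite !mxE => /eqP.
by rewrite eqr_int => /eqP.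
Qed.

Lemma intcv_col j : intcv (col j A) = a j.
Proof. by apply/colP => i; rewrite !mxE. Qed.

Hypothesis std : standing A.

Lemma standing_rank : \rank (Ar A) = d. Proof. by case: std => [[]]. Qed.

Lemma cone_pointed v : cone_of A setT v -> cone_of A setT (- v) -> v = 0.
Proof. by case: std => [[_ h]] *; apply: h. Qed.

Lemma nonneg_ker u : nonneg_vec u -> A *m u = 0 -> u = 0.
Proof.
move=> u0 Au; have [_ h _ _ _] := std; apply: intcv_inj.
rewrite (h (intcv u)) => [|j|]; first by apply/colP => j; rewrite !mxE.
  by rewrite mxE ler0z.
by rewrite -[Ar A *m _]map_mxM Au; apply/colP => j; rewrite !mxE.
Qed.

Lemma cone_lattice b : cone_of A setT (intcv b) -> exists2 u, nonneg_vec u & A *m u = b.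
Proof. by have [_ _ _ h _] := std; move/h => [u []]; exists u. Qed.

Lemma mul_delta j : A *m delta_mx j 0 = col j A. Proof. by rewrite colE. Qed.

Lemma col_neq0 j : a j <> 0.
Proof.
move=> e; have : A *m (delta_mx j 0 : 'cV_n) = 0.
  apply: intcv_inj; rewrite mul_delta intcv_col e.
  by apply/colP => i; rewrite !mxE.
move/nonneg_ker => /(_ _)/colP/(_ j); rewrite !mxE !eqxx => h.
by have : 1 = 0 :> int by apply: h => i; rewrite mxE ler0n.
Qed.

(** If [w] uses column k, subtracting it leaves a nonnegative element of the kernel, so [w] is a
    unit vector. If not, [w] can replace column k in every representation ([v'] below), and the
    remaining columns would be a Hilbert basis, against minimality. *)
Lemma col_irreducible k u u' : nonneg_vec u -> nonneg_vec u' ->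
  A *m u + A *m u' = col k A -> u = 0 \/ u' = 0.
Proof.
move=> u0 u0' e; pose w := u + u'; have Aw : A *m w = col k A by rewrite mulmxDr.
have w0 j : 0 <= w j 0 by rewrite mxE addr_ge0.
have [wk|wk] := eqVneq (w k 0) 0; last first.
  have : w - delta_mx k 0 = 0.
    apply: nonneg_ker => [j|]; last by rewrite mulmxBr Aw mul_delta subrr.
    rewrite !mxE andbT; have := w0 j; rewrite mxE.
    have [->|_] := eqVneq j k; last by rewrite subr0.
    by move: (w0 k) wk; rewrite !mxE /=; clear; lia.
  move/subr0_eq => ew; have wj j : u j 0 + u' j 0 = (j == k)%:R.
    by have := congr1 (fun v : 'cV_n => v j 0) ew; rewrite !mxE andbT.
  have sum0 (x y : int) : 0 <= x -> 0 <= y -> x + y = 0 -> x = 0 /\ y = 0 by lia.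
  have : u k 0 = 0 \/ u' k 0 = 0.
    by have := wj k; rewrite eqxx; move: (u0 k) (u0' k); clear; lia.
  case=> uk; [left|right]; apply/colP => j; rewrite mxE;
    have [->//|jk] := eqVneq j k; have := wj j; rewrite (negbTE jk) => h;
    by have [] := sum0 _ _ (u0 j) (u0' j) h.
have [_ _ _ _ [_ [_ hil] mini]] := std.
have : k \in [set~ k].
  rewrite (mini [set~ k]) ?inE //; split=> [j _|b /hil [v [v0 [_ Av]]]].
    exact: cone_col.
  pose v' := v - (v k 0) *: delta_mx k 0 + (v k 0) *: w.
  have v'E j : v' j 0 = v j 0 - v k 0 * (j == k)%:R + v k 0 * w j 0.
    by rewrite !mxE andbT.
  exists v'; split; [|split].
  - move=> j; rewrite v'E; have [->|_] := eqVneq j k; first by rewrite wk mulr1 mulr0 subrr.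
    by rewrite mulr0 subr0 addr_ge0 // mulr_ge0.
  - move=> j; rewrite !inE => /negP; rewrite negbK => /eqP ->.
    by rewrite v'E wk eqxx mulr1 mulr0 subrr.
  - by rewrite /v' mulmxDr mulmxBr -!scalemxAr mul_delta Aw subrK.
by rewrite !inE eqxx.
Qed.

Lemma lattice_irreducible k p q : cone_of A setT (intcv p) -> cone_of A setT (intcv q) ->
  p + q = col k A -> p = 0 \/ q = 0.
Proof.
move=> /cone_lattice[u u0 <-] /cone_lattice[u' u0' <-] /(col_irreducible u0 u0').
by case=> ->; rewrite mulmx0; [left|right].
Qed.

Lemma intcvD m (u v : 'cV[int]_m) : intcv (u + v) = intcv u + intcv v.
Proof. by rewrite /intcv map_mxD. Qed.

Lemma intcvB m (u v : 'cV[int]_m) : intcv (u - v) = intcv u - intcv v.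
Proof. by rewrite /intcv map_mxB. Qed.

Lemma intcv0 m : intcv (0 : 'cV[int]_m) = 0.
Proof. by apply/colP => i; rewrite !mxE. Qed.

(** With 0 < t < 1 the column would split into the lattice points t a_k and (1 - t) a_k. *)
Lemma col_primitive k (h : 'cV[int]_d) (t : RR) : intcv h = t *: a k -> 0 <= t < 1 -> t = 0.
Proof.
move=> eh /andP[t0 t1]; have [] := @lattice_irreducible k h (col k A - h).
- by rewrite eh; apply: coneZ => //; apply: cone_col.
- rewrite intcvB intcv_col eh -[X in X - _]scale1r -scalerBl; apply: coneZ (cone_col _).
  by rewrite subr_ge0 ltW.
- by rewrite addrC subrK.
- move=> h0; have := eh; rewrite h0 intcv0 => /esym/eqP; rewrite scaler_eq0.
  by case/orP => /eqP // /col_neq0.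
- move/subr0_eq => e; have := eh; rewrite -e intcv_col => /eqP.
  rewrite -subr_eq0 -[X in X - _]scale1r -scalerBl scaler_eq0.
  by case/orP => /eqP; [lra | move/col_neq0].
Qed.

(** As [P] lies on or beyond the ray of a_k, seen from [h], a positive multiple of a_k is a
    nonnegative combination of [P] and [h]; a nonpositive multiple [E] would contradict pointedness.
    If [P] were strictly below the line y = 1, on which a_k lies, a_k - P would stay in the cone,
    and irreducibility would give P = a_k. *)
Lemma half_plane k (h P : 'cV[int]_d) (e : 'cV[RR]_d) (y : 'rV[RR]_d) (al0 al1 p q : RR) :
  intcv h = al0 *: a k + al1 *: e -> intcv P = p *: a k + q *: e ->
  pairing A y k = 1 -> (y *m e) 0 0 = 1 -> 0 < al1 -> al0 + al1 <= 1 -> q <= 0 -> P <> 0 ->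
  cone_of A setT (intcv P) -> cone_of A setT (intcv (h - P)) ->
  1 <= (y *m intcv P) 0 0.
Proof.
move=> eh eP yk ye a10 asum q0 P0 cP chP.
have ch : cone_of A setT (intcv h).
  by have := coneD chP cP; rewrite -intcvD subrK.
pose E := al1 * p - q * al0.
have eE : al1 *: intcv P + (- q) *: intcv h = E *: a k.
  rewrite eh eP; apply/colP => i; rewrite !mxE /E; ring.
have [E0|E0] := leP E 0.
  case: P0; apply: intcv_inj; rewrite intcv0; apply/eqP.
  suff /eqP : al1 *: intcv P = 0 by rewrite scaler_eq0 gt_eqF.
  apply: cone_pointed; first by apply: coneZ => //; apply: ltW.
  have -> : - (al1 *: intcv P) = (- q) *: intcv h + (- E) *: a k.
    by rewrite [(- E) *: _]scaleNr -eE opprD addrCA subrr addr0.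
  by apply: coneD; apply: coneZ; rewrite ?oppr_ge0 //; apply: cone_col.
have [le|lt] := leP E (al1 - q).
  have [||||] := @lattice_irreducible k P (col k A - P) => //.
  - have -> : intcv (col k A - P) =
        E^-1 *: ((al1 - q - E) *: intcv P + (- q) *: intcv (h - P)).
      rewrite !intcvB intcv_col; apply: (scalerI (lt0r_neq0 E0)).
      rewrite scalerA divff ?gt_eqF // scale1r scalerBr -eE.
      by apply/colP => i; rewrite !mxE; ring.
    by apply: coneZ; rewrite ?invr_ge0 ?ltW //; apply: coneD; apply: coneZ; rewrite ?oppr_ge0 //; lra.
  - by rewrite addrC subrK.
  - by move/subr0_eq => <-; rewrite intcv_col -/(pairing A y k) yk.
have evD u v : (y *m (u + v)) 0 0 = (y *m u) 0 0 + (y *m v) 0 0 :> RR.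
  by rewrite mulmxDr mxE.
have evZ t v : (y *m (t *: v)) 0 0 = t * (y *m v) 0 0 :> RR by rewrite -scalemxAr mxE.
have : al1 * (y *m intcv P) 0 0 - q * (y *m intcv h) 0 0 = E.
  have := congr1 (fun v => (y *m v) 0 0) eE.
  by rewrite evD !evZ -/(pairing A y k) yk mulr1 mulNr.
have -> : (y *m intcv h) 0 0 = al0 + al1.
  by rewrite eh evD !evZ ye -/(pairing A y k) yk !mulr1.
by clear -lt E0 a10 asum q0; move: ((y *m _) 0 0) => z ez; nra.
Qed.

(** With one row the fractional point is a multiple t < 1 of a single column, which primitivity
    excludes: all determinants are at most 1 in absolute value. *)
Lemma standing_inner_columns1 : d = 1%N -> inner_columns A.
Proof.
move=> d1 s hs; have [h [al [eh al01 []]]] := fractional_point hs.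
apply/colP => k; rewrite mxE; apply: (@col_primitive (s k) h _ _ (al01 k)).
rewrite eh; apply/colP => i; rewrite !mxE (bigD1 k) //= big1 ?addr0.
  by rewrite !mxE mulrC.
move=> l /eqP []; apply: val_inj; move: l k {i} => [l hl] [k hk] /=.
by move: hl hk; rewrite d1; case: l k => [|?] [].
Qed.

End Standing.

Lemma nonneg_small n (u : 'cV[int]_n) : nonneg_vec u -> \sum_j u j 0 < 2 ->
  u = 0 \/ exists m, u = delta_mx m 0.
Proof.
move=> u0 hs; case: (classic (exists m, u m 0 <> 0)) => [[m um]|no]; last first.
  left; apply/colP => j; rewrite mxE.
  by apply: NNPP => h; apply: no; exists j.
right; exists m.
have rest0 : \sum_(j | j != m) u j 0 = 0 /\ u m 0 = 1.
  move: hs; rewrite (bigD1 m) //=; have : 0 <= \sum_(j | j != m) u j 0 by apply: sumr_ge0.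
  by move: (u0 m) um; move: (u m 0) (\sum_(_ | _) _); clear; lia.
apply/colP => j; rewrite mxE andbT; have [->|jm] := eqVneq j m; first by rewrite rest0.2.
have /eqP := rest0.1; rewrite psumr_eq0 // => /allP/(_ j (mem_index_enum j)).
by rewrite jm /= => /eqP.
Qed.

(** * Degrees, and inner columns for graded matrices with three rows *)

Section LowDimension.
Variables (d n : nat) (A : 'M[int]_(d, n)).
Local Notation a j := (col j (Ar A)).

Lemma colsub_mul (s : 'I_d -> 'I_n) (al : 'cV[RR]_d) :
  colsub s (Ar A) *m al = \sum_k al k 0 *: a (s k).
Proof.
apply/colP => i; rewrite mxE summxE; apply: eq_bigr => k _.
by rewrite !mxE mulrC.
Qed.

Lemma graded_unit : graded A -> exists w, forall j, pairing A w j = 1.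
Proof.
by case=> w [t [t0 h]]; exists (t^-1 *: w) => j; rewrite pairZ /pairing h mulVf.
Qed.

Lemma degree_mul w (u : 'cV[int]_n) : (forall j, pairing A w j = 1) ->
  (w *m intcv (A *m u)) 0 0 = (\sum_j u j 0)%:~R.
Proof.
move=> hw; rewrite pair_intcv rmorph_sum; apply: eq_bigr => j _.
by rewrite hw mul1r.
Qed.

Lemma degree_colsub w s (al : 'cV[RR]_d) : (forall j, pairing A w j = 1) ->
  (w *m (colsub s (Ar A) *m al)) 0 0 = \sum_k al k 0.
Proof.
move=> hw; rewrite colsub_mul mulmx_sumr summxE; apply: eq_bigr => k _.
by rewrite -scalemxAr mxE -/(pairing A w (s k)) hw mulr1.
Qed.

Hypothesis std : standing A.

Lemma lattice_degree w (b : 'cV[int]_d) : (forall j, pairing A w j = 1) ->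
  exists z : int, (w *m intcv b) 0 0 = z%:~R.
Proof.
move=> hw; have [_ _ h _ _] := std; have [u <-] := h b.
by rewrite degree_mul //; exists (\sum_j u j 0).
Qed.

(** By normality the point is a sum of columns, each of degree 1. *)
Lemma graded_column w (b : 'cV[int]_d) : (forall j, pairing A w j = 1) ->
  cone_of A setT (intcv b) -> (w *m intcv b) 0 0 < 2 ->
  b = 0 \/ exists m, b = col m A.
Proof.
move=> hw /(cone_lattice std)[u u0 <-]; rewrite degree_mul // -[2]/(2%:~R) ltr_int.
move=> /(nonneg_small u0)[->|[m ->]]; first by left; rewrite mulmx0.
by right; exists m; rewrite mul_delta.
Qed.

Lemma cone_colsub s (al : 'cV[RR]_d) : (forall k, 0 <= al k 0) ->
  cone_of A setT (colsub s (Ar A) *m al).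
Proof.
move=> al0; rewrite -mul_select_mx -mulmxA.
have -> : Ar A *m (select_mx _ s *m al) = comb A (fun x => (select_mx _ s *m al) x 0).
  by rewrite combE; congr (_ *m _); apply/colP => x; rewrite [RHS]mxE.
by apply: cone_setT => x; rewrite select_mxE sumr_ge0.
Qed.

(** Central symmetry of the parallelepiped: under a grading, the degrees of the two points add up to
    d. *)
Lemma complement_point s (h : 'cV[int]_d) (al : 'cV[RR]_d) :
  intcv h = colsub s (Ar A) *m al ->
  intcv (\sum_k col (s k) A - h) = colsub s (Ar A) *m (const_mx 1 - al).
Proof.
move=> eh; rewrite intcvB mulmxBr -eh; congr (_ - _); rewrite colsub_mul.
rewrite /intcv raddf_sum; apply: eq_bigr => k _; rewrite mxE scale1r.
exact: intcv_col.
Qed.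

(** A fractional point of degree below 2 is a column. Otherwise all three coordinates are positive,
    as two coordinates below 1 cannot reach 2; so its reflection again has coordinates below 1, and
    its degree is at most 1. *)
Lemma standing_inner_columns3 : d = 3%N -> graded A -> inner_columns A.
Proof.
move=> d3 /graded_unit[w hw] s hs; have [h [al [eh al01 alnz]]] := fractional_point hs.
have {}eh : intcv h = colsub s (Ar A) *m al.
  by rewrite eh; congr (_ *m _); apply/matrixP => i j; rewrite !mxE.
suff [h' [al' [eh' al01' alnz' small]]] : exists (h' : 'cV[int]_d) (al' : 'cV[RR]_d),
    [/\ intcv h' = colsub s (Ar A) *m al', forall k, 0 <= al' k 0 < 1,
       al' <> 0 & \sum_k al' k 0 < 2].
  have [] := @graded_column w h' hw.
  - by rewrite eh'; apply: cone_colsub => k; have /andP[] := al01' k.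
  - by rewrite eh' degree_colsub.
  - move=> h0; case: alnz'; have uR : colsub s (Ar A) \in unitmx.
      rewrite unitmxE det_colsub unitfE intr_eq0 -normr_gt0.
      exact: lt_trans ltr01 hs.
    by rewrite -(mulKmx uR al') -eh' h0 intcv0 mulmx0.
  - by case=> m hm; exists m, al'; rewrite -eh' hm intcv_col.
have [lt|ge] := ltP (\sum_k al k 0) 2; first by exists h, al.
have sumB : \sum_k (const_mx 1 - al : 'cV[RR]_d) k 0 = 3 - \sum_k al k 0.
  under eq_bigr do rewrite !mxE; rewrite sumrB; congr (_ - _).
  by rewrite sumr_const card_ord d3.
have [z ez] := @lattice_degree w h hw; rewrite eh degree_colsub // in ez.
have al_lt1 k : al k 0 < 1 by have /andP[] := al01 k.
have pos k : 0 < al k 0.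
  rewrite ltNge; apply/negP => alk; suff : \sum_k al k 0 < 2 by rewrite ltNge ge.
  rewrite (bigD1 k) //=; have [k2 kk2] : exists k2, k2 != k.
    have h0 : (0 < d)%N by rewrite d3. have h1 : (1 < d)%N by rewrite d3.
    have [->|ne] := eqVneq k (Ordinal h0); first by exists (Ordinal h1).
    by exists (Ordinal h0); rewrite eq_sym.
  apply: (@le_lt_trans _ _ (\sum_(i | i != k) al i 0)); first by rewrite gerDr.
  have -> : 2 = \sum_(i : 'I_d | i != k) 1 :> RR.
    by rewrite sumr_const cardC1 card_ord d3.
  by apply: ltr_sum => //; apply/hasP; exists k2; rewrite ?mem_index_enum.
exists (\sum_k col (s k) A - h), (const_mx 1 - al); split.
- exact: complement_point.
- by move=> k; rewrite !mxE; have := pos k; have := al_lt1 k; clear => *; apply/andP; split; lra.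
- move=> e; have h0 : (0 < d)%N by rewrite d3.
  have := al_lt1 (Ordinal h0); have := congr1 (fun v : 'cV_d => v (Ordinal h0) 0) e.
  by rewrite !mxE; lra.
- by rewrite sumB; lra.
Qed.

End LowDimension.

(** Up to reflection [h] lies in the triangle below the line through both generators, where y = 1.
    Split a representation of [h] into [P] and [Q], on or beyond the two rays, and the interior part
    [I]. By [half_plane] each of [P] and [Q], if nonzero, has y-value at least 1, which already
    exhausts that of [h]; so both vanish. *)
Lemma standing_inner_columns2 n (A : 'M[int]_(2, n)) : standing A -> inner_columns A.
Proof.
move=> std s hs; have [h0 [al0 [eh0 al01 alnz]]] := fractional_point hs.
have {}eh0 : intcv h0 = colsub s (Ar A) *m al0.
  by rewrite eh0; congr (_ *m _); apply/matrixP => i j; rewrite !mxE.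
have uR : colsub s (Ar A) \in unitmx.
  rewrite unitmxE det_colsub unitfE intr_eq0 -normr_gt0; exact: lt_trans ltr01 hs.
have E2 (al : 'cV[RR]_2) : colsub s (Ar A) *m al =
    al 0 0 *: col (s 0) (Ar A) + al 1 0 *: col (s 1) (Ar A).
  by rewrite colsub_mul !big_ord_recl big_ord0 addr0; congr (_ + al _ _ *: col (s _) _); apply: val_inj.
have ord2 (k : 'I_2) : k = 0 \/ k = 1.
  by case: k => [[|[|//]] hk]; [left|right]; apply: val_inj.
(* A zero coordinate would leave a proper multiple of one column, contrary to primitivity. *)
have pos k : 0 < al0 k 0.
  rewrite lt_neqAle eq_sym; have /andP[-> _] := al01 k; rewrite andbT.
  apply/eqP => ak; apply: alnz; apply/colP => l; rewrite mxE.
  have prim l' : al0 l' 0 = 0 -> forall l, al0 l 0 = 0.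
    move=> al' l2; have [->//|ll] := eqVneq l2 l'.
    apply: (@col_primitive _ _ _ std (s l2) h0 _ _ (al01 l2)).
    rewrite eh0 E2; move: ll al'; case: (ord2 l2) => ->; case: (ord2 l') => -> //= _ ->.
      by rewrite scale0r addr0.
    by rewrite scale0r add0r.
  exact: prim ak l.
have [h [al [eh al_pos al_sum]]] : exists (h : 'cV[int]_2) (al : 'cV[RR]_2),
    [/\ intcv h = colsub s (Ar A) *m al, forall k, 0 < al k 0 < 1 & al 0 0 + al 1 0 <= 1].
  have [le|lt] := leP (al0 0 0 + al0 1 0) 1.
    by exists h0, al0; split=> // k; rewrite pos; have /andP[] := al01 k.
  exists (\sum_k col (s k) A - h0), (const_mx 1 - al0); split.
  - exact: complement_point.
  - move=> k; rewrite !mxE; have := pos k; have /andP[_] := al01 k; clear => *.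
    by apply/andP; split; lra.
  - by rewrite !mxE; lra.
pose C := invmx (colsub s (Ar A)).
pose p (v : 'cV[RR]_2) : RR := (C *m v) 0 0; pose q (v : 'cV[RR]_2) : RR := (C *m v) 1 0.
have vE v : v = p v *: col (s 0) (Ar A) + q v *: col (s 1) (Ar A).
  by rewrite /p /q -E2 mulmxA mulmxV // mul1mx.
have pD u v : p (u + v) = p u + p v by rewrite /p mulmxDr mxE.
have qD u v : q (u + v) = q u + q v by rewrite /q mulmxDr mxE.
have Ccol k : C *m col (s k) (Ar A) = delta_mx k 0.
  have -> : col (s k) (Ar A) = col k (colsub s (Ar A)) by apply/colP => i; rewrite !mxE.
  by rewrite -col_mul mulVmx //; apply/colP => i; rewrite !mxE eqxx andbT.
pose y : 'rV[RR]_2 := const_mx 1 *m C.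
have yE v : (y *m v) 0 0 = p v + q v.
  rewrite -mulmxA mxE !big_ord_recl big_ord0 addr0 ![const_mx _ _ _]mxE !mul1r; congr (_ + (C *m v) _ _).
  exact: val_inj.
have yk k : (y *m col (s k) (Ar A)) 0 0 = 1.
  rewrite yE /p /q Ccol !mxE; case: (ord2 k) => ->; by rewrite !eqxx /= ?addr0 ?add0r.
have ph : p (intcv h) = al 0 0 by rewrite /p eh mulKmx.
have qh : q (intcv h) = al 1 0 by rewrite /q eh mulKmx.
have [u u0 Au] : exists2 u, nonneg_vec u & A *m u = h.
  apply: (cone_lattice std); rewrite eh; apply: cone_colsub => k.
  by have /andP[/ltW] := al_pos k.
have sumE (f : 'cV[RR]_2 -> RR) (i : 'I_2) (v : 'cV[int]_n) :
    f =1 (fun x => (C *m x) i 0) -> f (intcv (A *m v)) = \sum_j (v j 0)%:~R * f (col j (Ar A)).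
  move=> fE; rewrite fE intcv_mul mulmx_sumr summxE; apply: eq_bigr => j _.
  by rewrite fE -scalemxAr mxE.
have pS v : p (intcv (A *m v)) = \sum_j (v j 0)%:~R * p (col j (Ar A)) by apply: (sumE p 0).
have qS v : q (intcv (A *m v)) = \sum_j (v j 0)%:~R * q (col j (Ar A)) by apply: (sumE q 1).
pose isP j := q (col j (Ar A)) <= 0.
pose isQ j := ~~ isP j && (p (col j (Ar A)) <= 0).
pose part (T : pred 'I_n) : 'cV[int]_n := \col_j if T j then u j 0 else 0.
have part0 T : nonneg_vec (part T) by move=> j; rewrite mxE; case: ifP.
pose isI j := ~~ isP j && ~~ isQ j.
have hsplit : h = A *m part isP + A *m part isQ + A *m part isI.
  rewrite -!mulmxDr -Au; congr (_ *m _); apply/colP => j; rewrite !mxE /isI /isQ.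
  by case: (isP j); case: (_ <= _); rewrite /= ?addr0 ?add0r.
set P := A *m part isP in hsplit; set Q := A *m part isQ in hsplit.
set I := A *m part isI in hsplit.
have cP : cone_of A setT (intcv P) by apply: cone_intcv_mul.
have cQ : cone_of A setT (intcv Q) by apply: cone_intcv_mul.
have cI : cone_of A setT (intcv I) by apply: cone_intcv_mul.
have partS (f : 'cV[RR]_2 -> RR) T : \sum_j ((part T) j 0)%:~R * f (col j (Ar A)) =
    \sum_(j | T j) (u j 0)%:~R * f (col j (Ar A)).
  rewrite [in RHS]big_mkcond; apply: eq_bigr => j _; rewrite mxE.
  by case: ifP => // _; rewrite mul0r.
have qP : q (intcv P) <= 0.
  rewrite qS partS; apply: sumr_le0 => j hj.
  by rewrite mulr_ge0_le0 // ler0z.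
have pQ : p (intcv Q) <= 0.
  rewrite pS partS; apply: sumr_le0 => j /andP[_ hj].
  by rewrite mulr_ge0_le0 // ler0z.
have inI j : isI j -> 0 < p (col j (Ar A)) /\ 0 < q (col j (Ar A)).
  by rewrite /isI /isQ => /andP[hq]; rewrite hq /= -ltNge => hp; rewrite hp ltNge.
have pI : 0 <= p (intcv I).
  rewrite pS partS; apply: sumr_ge0 => j /inI[h1 h2]; by rewrite mulr_ge0 ?ler0z // ltW.
have qI : 0 <= q (intcv I).
  rewrite qS partS; apply: sumr_ge0 => j /inI[h1 h2]; by rewrite mulr_ge0 ?ler0z // ltW.
have sp : al 0 0 = p (intcv P) + p (intcv Q) + p (intcv I).
  by rewrite -ph hsplit !intcvD !pD.
have sq : al 1 0 = q (intcv P) + q (intcv Q) + q (intcv I).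
  by rewrite -qh hsplit !intcvD !qD.
have /andP[a0 a01] := al_pos 0; have /andP[a1 a11] := al_pos 1.
have ehE : intcv h = al 0 0 *: col (s 0) (Ar A) + al 1 0 *: col (s 1) (Ar A).
  by rewrite eh E2.
have lP : P <> 0 -> 1 <= p (intcv P) + q (intcv P).
  move=> P0; rewrite -yE.
  apply: (@half_plane _ _ _ std (s 0) h P _ y _ _ _ _ ehE (vE (intcv P))) => //.
  - exact: yk.
  - have -> : h - P = Q + I by rewrite hsplit -[P + Q + I]addrA [P + _]addrC addrK.
    by rewrite intcvD; apply: coneD.
have lQ : Q <> 0 -> 1 <= p (intcv Q) + q (intcv Q).
  move=> Q0; rewrite -yE.
  have eQ := vE (intcv Q); rewrite addrC in eQ; rewrite addrC in ehE.
  apply: (@half_plane _ _ _ std (s 1) h Q _ y _ _ _ _ ehE eQ) => //.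
  - exact: yk.
  - by rewrite addrC.
  - have -> : h - Q = P + I by rewrite hsplit addrAC addrK.
    by rewrite intcvD; apply: coneD.
have z0 : p (intcv (0 : 'cV[int]_2)) = 0 /\ q (intcv (0 : 'cV[int]_2)) = 0.
  by rewrite intcv0 /p /q mulmx0 !mxE.
have [P0|P0] := eqVneq P 0; last first.
  have := lP (elimN eqP P0); have [Q0|/eqP/lQ hQ] := eqVneq Q 0.
    by move: sp sq; rewrite Q0 z0.1 z0.2; clear -a0 a1 al_sum pI qI qP; lra.
  by clear -sp sq al_sum pI qI hQ; lra.
have [Q0|Q0] := eqVneq Q 0; last first.
  have := lQ (elimN eqP Q0).
  by move: sp sq; rewrite P0 z0.1 z0.2; clear -a0 a1 al_sum pI qI pQ; lra.
rewrite P0 Q0 z0.1 z0.2 !add0r in sp sq.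
(* All summands of [h] now have positive coordinates, so any column used is bounded coordinatewise
   by [h]. *)
have [j [hj uj]] : exists j, isI j /\ u j 0 != 0.
  apply: NNPP => no; suff : p (intcv I) = 0 by rewrite -sp => e; rewrite e ltxx in a0.
  rewrite pS partS big1 // => j hj; have [->|uj] := eqVneq (u j 0) 0; first by rewrite mul0r.
  by case: no; exists j.
have u1 : 1 <= (u j 0)%:~R :> RR.
  by rewrite -[1]/(1%:~R) ler_int; move: (u0 j) uj; clear; lia.
have [pj qj] := inI _ hj.
exists j, (C *m col j (Ar A)); split; first by rewrite mulmxA mulmxV // mul1mx.
have pj1 : p (col j (Ar A)) <= al 0 0.
  rewrite sp pS partS (bigD1 j) //=; apply: (@le_trans _ _ ((u j 0)%:~R * p (col j (Ar A)))).
    by rewrite ler_peMl // ltW.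
  rewrite lerDl; apply: sumr_ge0 => i /andP[/inI[h1 h2] _]; by rewrite mulr_ge0 ?ler0z // ltW.
have qj1 : q (col j (Ar A)) <= al 1 0.
  rewrite sq qS partS (bigD1 j) //=; apply: (@le_trans _ _ ((u j 0)%:~R * q (col j (Ar A)))).
    by rewrite ler_peMl // ltW.
  rewrite lerDl; apply: sumr_ge0 => i /andP[/inI[h1 h2] _]; by rewrite mulr_ge0 ?ler0z // ltW.
move=> k; case: (ord2 k) => ->; apply/andP; split.
- exact: ltW.
- exact: le_lt_trans pj1 a01.
- exact: ltW.
- exact: le_lt_trans qj1 a11.
Qed.

Lemma part_i d n (A : 'M[int]_(d, n)) : standing A ->
  (d = 1%N \/ d = 2%N \/ (graded A /\ d = 3%N)) ->
  forall D : {set 'I_n} -> Prop, regular_triangulation A D -> exists c, supports A D c.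
Proof.
move=> std hd D [tri [c0 hD]].
have DE : D = Delta A c0 by apply: funext => s; apply: propext.
have inner : inner_columns A.
  case: hd => [d1|[d2|[gr d3]]]; first exact: standing_inner_columns1.
    by move: A std {tri hD DE}; rewrite d2; exact: standing_inner_columns2.
  exact: standing_inner_columns3.
have rk := standing_rank std; have nz := col_neq0 std.
rewrite DE in tri *; apply: Delta_normal_supports => //.
exact: inner_columns_Delta_normal.
Qed.

(** * Uniqueness for graded matrices with two rows *)

Lemma optG_shift d n (A : 'M[int]_(d, n)) c (sigma : {set 'I_n}) y b x (z : 'cV[int]_n) :
  (forall j, j \notin sigma -> z j 0 = 0) ->
  optG A c sigma y b x -> optG A c sigma y (b + A *m z) (x + z).
Proof.
move=> hz [[fx ex] ox].
have gz (x' : 'cV[int]_n) : gcost A c sigma y (x' + z) = gcost A c sigma y x'.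
  by apply: eq_bigr => j hj; rewrite [(x' + z) _ _]mxE (hz j hj) addr0.
split; first by split=> [j hj|]; [rewrite mxE hz // addr0; exact: fx | rewrite mulmxDr ex].
move=> x' [fx' ex']; rewrite gz -(subrK z x') gz; apply: ox; split=> [j hj|].
  by rewrite !mxE hz // subr0 fx'.
by rewrite mulmxBr ex' addrK.
Qed.

Section GradedPlane.
Variables (n : nat) (A : 'M[int]_(2, n)) (w : 'rV[RR]_2).
Local Notation a j := (col j (Ar A)).
Hypotheses (std : standing A) (hw : forall j, pairing A w j = 1).
Implicit Types (c : 'rV[RR]_n) (sigma tau : {set 'I_n}).

Lemma col_injective (i j : 'I_n) : col i A = col j A -> i = j.
Proof. by have [_ _ _ _ [h _ _]] := std; exact: h. Qed.

(** Degree 1 leaves room for a single column. *)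
Lemma col_unique_solution (x : 'cV[int]_n) m : nonneg_vec x -> A *m x = col m A ->
  x = delta_mx m 0.
Proof.
move=> x0 e; have : (\sum_j x j 0)%:~R = 1 :> RR.
  by rewrite -(degree_mul _ hw) e intcv_col; exact: hw.
move=> /eqP; rewrite -[1]/(1%:~R) eqr_int => /eqP s1.
have [|x00|[j ej]] := nonneg_small x0; first by rewrite s1.
  by move: s1; rewrite x00 big1 // => k _; rewrite mxE.
by move: e; rewrite ej mul_delta => /col_injective ->.
Qed.

(** [z] consists of the floors of the coordinates. The remainder has two coordinates below 1, hence
    degree below 2, so it is 0 or a column. *)
Lemma cell_decomposition sigma M (b : 'cV[int]_2) : inverse_on A sigma M ->
  exists z : 'cV[int]_n, [/\ forall j, j \notin sigma -> z j 0 = 0,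
    cone_of A sigma (intcv b) -> nonneg_vec z &
    b = A *m z \/ exists m, [/\ m \notin sigma, cone_of A sigma (a m) &
                                b = A *m z + col m A]].
Proof.
move=> hM; pose z : 'cV[int]_n := \col_i Num.floor ((M *m intcv b) i 0).
have zout j : j \notin sigma -> z j 0 = 0.
  by move=> hj; rewrite mxE (inv_out hM) // floor0.
pose h := b - A *m z.
have Mh k : (M *m intcv h) k 0 =
    (M *m intcv b) k 0 - (Num.floor ((M *m intcv b) k 0))%:~R.
  rewrite intcvB mulmxBr intcv_mul mxE; congr (_ + _); rewrite mxE; congr (- _).
  by rewrite (inv_comb hM) => [|j /zout ->//]; rewrite mxE.
have Mh01 k : 0 <= (M *m intcv h) k 0 < 1 by rewrite Mh; exact: floor_frac.
have hcone : cone_of A sigma (intcv h).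
  by apply/(coneP hM) => k; have /andP[] := Mh01 k.
have hdeg : (w *m intcv h) 0 0 < 2.
  rewrite -(comb_inv hM (intcv h)) mul_comb.
  apply: (@lt_le_trans _ _ (\sum_(k in sigma) 1)); last first.
    by rewrite sumr_const (card_cell hM).
  rewrite (bigID (fun k => k \in sigma)) /= [X in _ + X]big1 ?addr0; last first.
    by move=> k hk; rewrite (inv_out hM) // mul0r.
  have [k hk] : exists k, k \in sigma by apply/card_gt0P; rewrite (card_cell hM).
  apply: ltr_sum; first by apply/hasP; exists k; rewrite ?mem_index_enum.
  by move=> i _; rewrite hw mulr1; have /andP[] := Mh01 i.
exists z; split=> //.
  by move=> /(coneP hM) hb j; rewrite mxE real_floor_ge0 ?num_real.
have eb : b = A *m z + h by rewrite addrC subrK.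
have [h0|[m hm]] := graded_column std hw (cone_sub (subsetT _) hcone) hdeg.
  by left; rewrite {1}eb h0 addr0.
right; exists m; split; last by rewrite {1}eb hm.
  apply/negP => ms; have /andP[_] := Mh01 m.
  by rewrite hm intcv_col (inv_col hM) // mxE !eqxx ltxx.
by rewrite -intcv_col -hm.
Qed.

(** Two different cells share at most one generator; a_m in their intersection would be a multiple
    of it, and by degree equal to it. *)
Lemma interior_column_cell c sigma tau M m : inverse_on A sigma M ->
  max_face (Delta A c) sigma -> max_face (Delta A c) tau -> m \notin sigma ->
  cone_of A sigma (a m) -> cone_of A tau (a m) -> sigma = tau.
Proof.
move=> hM ms mt hm hs ht; apply: NNPP => ne.
have /cone_comb[l [l0 lout lE]] := Delta_inter ms.1 mt.1 hs ht.
have pr : sigma :&: tau \proper sigma.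
  rewrite properEneq subsetIl andbT; apply/eqP => e; apply: ne; symmetry.
  by apply: ms.2 mt.1 _; apply/setIidPl.
have := proper_card pr; rewrite (card_cell hM) ltnS leq_eqVlt ltnS leqn0 => /orP[/cards1P[i ei]|].
  have li : forall j, j != i -> l j = 0 by move=> j ji; apply: lout; rewrite ei inE.
  have eq : a m = l i *: a i.
    by rewrite lE /comb (bigD1 i) //= big1 ?addr0 // => j /li ->; rewrite scale0r.
  have l1 : l i = 1.
    by have := hw m; rewrite /pairing eq -scalemxAr mxE -/(pairing A w i) hw mulr1.
  have mi : m = i.
    apply: col_injective; apply: intcv_inj; rewrite !intcv_col.
    by rewrite eq l1 scale1r.
  have : i \in sigma :&: tau by rewrite ei inE.
  by rewrite inE -mi (negbTE hm).
rewrite cards_eq0 => /eqP e0; apply: (@col_neq0 _ _ _ std m).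
by rewrite lE /comb big1 // => j _; rewrite lout ?scale0r // e0 inE.
Qed.

(* Among the interior columns m which are not optimal in their own cell, take one
   of maximal reduced cost. Some other cell tau solves a_m, where a_m is congruent
   to an interior column m' of tau with a larger reduced cost; by uniqueness of
   optima m' cannot be optimal in tau either. *)
Lemma interior_column_optimal c sigma M m :
  supports A (Delta A c) c -> max_face (Delta A c) sigma -> inverse_on A sigma M ->
  m \notin sigma -> cone_of A sigma (a m) ->
  optG A c sigma (c *m M) (col m A) (delta_mx m 0).
Proof.
move=> [[tri uniq] _ gom] ms hM hm hc; have rk := standing_rank std.
have /boolp.choice[Mf hMf] : forall sigma, exists M : 'M[RR]_(n, 2),
    max_face (Delta A c) sigma -> inverse_on A sigma M.
  move=> s; case: (classic (max_face (Delta A c) s)) => [h|nm]; last by exists 0 => /nm.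
  by have [M' hM'] := max_face_inverse rk tri h; exists M'.
have -> : c *m M = c *m Mf sigma.
  by apply: (inv_pairE (hMf _ ms)) => i; exact: inv_pair.
pose opt (p : {set 'I_n} * 'I_n) :=
  optG A c p.1 (c *m Mf p.1) (col p.2 A) (delta_mx p.2 0).
pose bad (p : {set 'I_n} * 'I_n) := `[< [/\ max_face (Delta A c) p.1, p.2 \notin p.1,
  cone_of A p.1 (a p.2) & ~ opt p] >].
pose F (p : {set 'I_n} * 'I_n) := rcost A c (Mf p.1) p.2.
apply: NNPP => hbad; have bad0 : bad (sigma, m) by apply/asboolP.
case: (@arg_maxP _ _ _ _ bad F bad0) => [[{ms hM hm hc hbad bad0}sigma {}m]].
move=> /asboolP[/= ms hm hc nopt] maxF.
have dE k : A *m delta_mx k 0 = col k A by rewrite mul_delta.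
have d0 k : nonneg_vec (delta_mx k 0 : 'cV[int]_n) by move=> j; rewrite mxE ler0n.
have wit s : max_face (Delta A c) s -> witness A c s (c *m Mf s).
  move=> hs; case: (hs.1) => y hy.
  by rewrite -(inv_pairE (hMf _ hs) (y := y)) // => i hi; apply: (hy i).1.
have rpos s k : max_face (Delta A c) s -> k \notin s -> 0 < rcost A c (Mf s) k.
  by move=> hs hk; rewrite subr_gt0; apply: (wit _ hs k).2.
have gd (s : {set 'I_n}) (k : 'I_n) : k \notin s -> gcost A c s (c *m Mf s) (delta_mx k 0) = rcost A c (Mf s) k.
  move=> hk; rewrite /gcost (bigD1 k) //= big1 ?addr0 => [|j /andP[_ jk]].
    by rewrite [delta_mx _ _ _ _]mxE !eqxx mulr1.
  by rewrite [delta_mx _ _ _ _]mxE (negbTE jk) mulr0.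
have gz (s : {set 'I_n}) (z x : 'cV[int]_n) : (forall j, j \notin s -> z j 0 = 0) ->
    gcost A c s (c *m Mf s) (x + z) = gcost A c s (c *m Mf s) x.
  by move=> hz; apply: eq_bigr => j hj; rewrite [(x + z) _ _]mxE (hz j hj) addr0.
have [|tau [mt sol]] := gom (col m A); first by exists (delta_mx m 0).
have [x [ox x0]] := sol _ (fun j hj => inv_pair (hMf _ mt) c hj).
have {x0} ex : x = delta_mx m 0 by apply: col_unique_solution => //; exact: ox.1.2.
rewrite {}ex in ox.
have nct : ~ cone_of A tau (a m).
  move=> ht; apply: nopt; rewrite /opt /=.
  by rewrite (interior_column_cell (hMf _ ms) ms mt hm hc ht).
have mtau : m \notin tau.
  apply/negP => h; apply: nct; rewrite -comb_delta; apply/cone_comb.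
  exists (fun i => (i == m)%:R); split=> // i hi.
  by case: eqP hi => // ->; rewrite h.
(* On the generators of [sigma] the witness of [tau] is at most [c], strictly so at some generator
   that a_m uses, because a_m lies outside the cone of [tau]. *)
have Fm : rcost A c (Mf sigma) m < rcost A c (Mf tau) m.
  rewrite /rcost ltrD2l ltrN2; have /cone_comb[l [l0 lout lE]] := hc.
  rewrite /pairing lE !mul_comb -subr_gt0 -sumrB lt_neqAle.
  have term i : 0 <= l i * pairing A (c *m Mf sigma) i - l i * pairing A (c *m Mf tau) i.
    rewrite -mulrBr; have [hi|/lout ->] := boolP (i \in sigma); last by rewrite mul0r.
    rewrite mulr_ge0 // (inv_pair (hMf _ ms)) // subr_ge0.
    have [h|h] := boolP (i \in tau); first by rewrite (inv_pair (hMf _ mt)).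
    by apply: ltW; apply: (wit _ mt i).2.
  rewrite sumr_ge0 // andbT eq_sym psumr_eq0 //; apply/negP => /allP h.
  apply: nct; rewrite lE; apply/cone_comb; exists l; split=> // i hi.
  have [is_|/lout //] := boolP (i \in sigma).
  have := h i (mem_index_enum i); rewrite /= -mulrBr mulf_eq0 => /orP[/eqP //|].
  rewrite (inv_pair (hMf _ ms)) // subr_eq0 => /eqP e.
  by have := (wit _ mt i).2 hi; rewrite e ltxx.
(* If a_m were congruent to 0 modulo [tau], group cost 0 would beat its positive reduced cost. *)
have [z [zout _ [ez|[m' [hm' hc' ez]]]]] := cell_decomposition (col m A) (hMf _ mt).
  have := ox.2 z; rewrite gd // /gcost big1 => [h|j /zout ->]; last by rewrite mulr0.
  by have := rpos _ _ mt mtau; rewrite ltNge h //; split=> [j /zout ->|].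
have le1 : rcost A c (Mf tau) m <= rcost A c (Mf tau) m'.
  have := ox.2 (delta_mx m' 0 + z); rewrite gd // gz // gd //; apply; split.
    by move=> j hj; rewrite mxE zout // addr0 d0.
  by rewrite mulmxDr dE addrC.
have om' : opt (tau, m').
  apply: NNPP => no; have : bad (tau, m') by apply/asboolP.
  by move/maxF; rewrite leNgt /F /= (lt_le_trans Fm).
(* Adding |z| on the generators of [tau] makes both group optima nonnegative, hence two different
   optima of one integer program. *)
pose N : 'cV[int]_n := \col_j `|z j 0|.
have Nout j : j \notin tau -> N j 0 = 0 by move=> hj; rewrite mxE zout.
have o1 := optG_shift Nout ox.
have zNout j : j \notin tau -> (z + N) j 0 = 0 by move=> hj; rewrite mxE zout // Nout.
have o2 := optG_shift zNout om'; rewrite mulmxDr addrA [_ + A *m z]addrC -ez /= in o2.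
have N0 : nonneg_vec N by move=> j; rewrite mxE.
have zN0 : nonneg_vec (z + N).
  by move=> j; rewrite !mxE -lerBlDl sub0r -normrN ler_norm.
have add0 (u v : 'cV[int]_n) : nonneg_vec u -> nonneg_vec v -> nonneg_vec (u + v).
  by move=> hu hv j; rewrite mxE addr_ge0.
have ip1 := optG_optIP (fun j hj => inv_pair (hMf _ mt) c hj) o1 (add0 _ _ (d0 _) N0).
have ip2 := optG_optIP (fun j hj => inv_pair (hMf _ mt) c hj) o2 (add0 _ _ (d0 _) zN0).
have [|x1 [_ un]] := uniq (col m A + A *m N).
  by exists (delta_mx m 0 + N); split; [exact: add0 | exact: ip1.1.2].
have := congr1 (fun v : 'cV_n => v m 0) (etrans (esym (un _ ip1)) (un _ ip2)).
rewrite !mxE (zout m) // normr0 !eqxx !addr0 andbT.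
by case: eqP => // mm'; case: nct; rewrite mm'.
Qed.

(** The optimum for [b] depends only on the cell containing [b]: the floors there, plus at most one
    interior column. *)
Lemma graded_plane_Oc c c' : supports A (Delta A c) c -> supports A (Delta A c) c' ->
  forall x, Oc A c x -> Oc A c' x.
Proof.
move=> sc sc' x [b [hb ox]]; exists b; split=> //.
have DE : Delta A c = Delta A c'.
  by have [_ h _] := sc'; apply: funext => s; apply: propext.
have [u [u0 Au]] := hb; have [[tri uniq] _ _] := sc.
have [|sigma [ms hbc]] := cone_max_face tri (v := intcv b).
  by rewrite -Au; exact: cone_intcv_mul.
have [M hM] := max_face_inverse (standing_rank std) tri ms.
have [z [zout /(_ hbc) z0 dec]] := cell_decomposition b hM.
(* [xb] is chosen before the cost; this order of quantifiers identifies the two sets of optima. *)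
suff [xb hx] : exists xb, forall c1, supports A (Delta A c) c1 -> Delta A c = Delta A c1 ->
    optIP A c1 b xb.
  have [x1 [_ un]] := uniq b hb.
  by rewrite -(un _ ox) (un _ (hx c sc erefl)); apply: hx.
have [eb|[m [hm hc eb]]] := dec.
  exists z => c1 sc1 D1; rewrite D1 in ms.
  have wit : witness A c1 sigma (c1 *m M).
    case: (ms.1) => y hy; rewrite -(inv_pairE hM (y := y)) // => i hi.
    exact: (hy i).1.
  apply: (optG_optIP (fun j hj => inv_pair hM c1 hj)) z0; split.
    by split=> // j /zout ->.
  move=> x' [fx' _]; rewrite /gcost big1 => [|j /zout ->]; last by rewrite mulr0.
  apply: sumr_ge0 => j hj; rewrite mulr_ge0 ?ler0z ?fx' // subr_ge0 ltW //.
  exact: (wit j).2.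
exists (delta_mx m 0 + z) => c1 sc1 D1; rewrite D1 in ms sc1.
have o := optG_shift zout (interior_column_optimal sc1 ms hM hm hc).
rewrite addrC -eb in o; apply: (optG_optIP (fun j hj => inv_pair hM c1 hj) o).
by move=> j; rewrite !mxE addr_ge0 ?ler0n.
Qed.

End GradedPlane.

Lemma part_ii n (A : 'M[int]_(2, n)) : standing A -> graded A ->
  forall D, regular_triangulation A D ->
  (exists c, supports A D c) /\
  (forall c c', supports A D c -> supports A D c' -> forall x, Oc A c x <-> Oc A c' x).
Proof.
move=> std gr D reg; split; first by apply: part_i => //; right; left.
have [w hw] := graded_unit gr.
have eqD c : supports A D c -> D = Delta A c.
  by case=> _ h _; apply: funext => s; apply: propext.
move=> c c' sc sc' x; have e := eqD _ sc; have e' := eqD _ sc'.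
by split; apply: (graded_plane_Oc std hw); rewrite -?e -?e'.
Qed.

(** * Certificates for explicit matrices *)

(** Once simplicial faces cover the cone, [Delta_sub] puts every face inside one of them, so
    independence passes to all; intersections are handled by weak duality. *)
Lemma Delta_triangulation d n (A : 'M[int]_(d, n)) c (T : {set 'I_n} -> Prop) :
  (forall sigma, T sigma -> Delta A c sigma) -> (forall sigma, T sigma -> indep A sigma) ->
  (forall v, cone_of A setT v -> exists2 sigma, T sigma & cone_of A sigma v) ->
  is_triangulation A (Delta A c) /\
  (forall tau, Delta A c tau -> exists2 sigma, T sigma & tau \subset sigma).
Proof.
move=> TD Tind cov.
have sub tau : Delta A c tau -> exists2 sigma, T sigma & tau \subset sigma.
  move=> ht; have [sigma hs hc] := cov _ (cone_setT A (l := fun j => (j \in tau)%:R) (fun j => ler0n _ _)).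
  by exists sigma => //; apply: Delta_sub ht hc; apply: TD.
split=> //; split.
- move=> sigma tau hs ts; have [rho hr sr] := sub _ hs.
  have [M hM] := indep_dual_basis (Tind _ hr).
  exact: (Delta_face hM (TD _ hr) (subset_trans ts sr)).
- move=> sigma hs l lout; have [rho hr sr] := sub _ hs; apply: Tind hr _ _ => j hj.
  by apply: lout; apply: contra hj; apply: (subsetP sr).
- move=> v; split=> [/cov[sigma hs hv]|[sigma [_ hv]]]; first by exists sigma; split=> //; apply: TD.
  exact: cone_sub (subsetT _) hv.
- by move=> sigma tau v; apply: Delta_inter.
Qed.

(** The positive functional [y] gives pointedness and the trivial kernel, the integral right inverse
    [R] gives the rank and the lattice. A column that occurs in each of its own representations
    cannot be dropped from the Hilbert basis. *)
Lemma standing_criterion d n (A : 'M[int]_(d, n)) (y : 'rV[RR]_d) (R : 'M[int]_(n, d)) :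
  (forall j, 0 < pairing A y j) -> A *m R = 1%:M ->
  (forall b, cone_of A setT (intcv b) -> inNA A b) ->
  injective (fun j => col j A) ->
  (forall k u, nonneg_vec u -> A *m u = col k A -> u k 0 <> 0) -> standing A.
Proof.
move=> hy hR hil inj irr.
have ker (x : 'cV[RR]_n) : (forall j, 0 <= x j 0) -> Ar A *m x = 0 -> x = 0.
  move=> x0 Ax; have : \sum_j x j 0 * pairing A y j = 0.
    rewrite -mul_comb combE (_ : \col_j x j 0 = x) ?Ax ?mulmx0 ?mxE //.
    by apply/colP => j; rewrite mxE.
  move/eqP; rewrite psumr_eq0 => [/allP h|j _]; last by rewrite mulr_ge0 // ltW.
  apply/colP => j; rewrite mxE; have := h j (mem_index_enum j).
  by rewrite /= mulf_eq0 => /orP[/eqP //|]; rewrite gt_eqF.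
have inN b : inNA A b <-> cone_of A setT (intcv b).
  by split=> [[u [u0 <-]]|/hil //]; apply: cone_intcv_mul.
split=> //.
- split; last first.
    move=> v /cone_comb[l [l0 _ ->]] /cone_comb[l' [l0' _ e]].
    have /ker h : forall j, 0 <= (\col_j (l j + l' j) : 'cV[RR]_n) j 0.
      by move=> j; rewrite mxE addr_ge0.
    have : \col_j (l j + l' j) = 0 :> 'cV[RR]_n.
      apply: h; rewrite (_ : \col__ _ = \col_j l j + \col_j l' j); last first.
        by apply/colP => j; rewrite !mxE.
      by rewrite mulmxDr -!combE -e subrr.
    move/colP => hl; rewrite /comb big1 // => j _.
    have := hl j; rewrite !mxE => /eqP; rewrite paddr_eq0 // => /andP[/eqP -> _].
    by rewrite scale0r.
  apply/eqP; rewrite -/(row_free _); apply/row_freeP.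
  exists (map_mx (fun z : int => z%:~R) R); rewrite -map_mxM hR.
  by apply/matrixP => i j; rewrite !mxE; case: (_ == _).
- by move=> b; exists (R *m b); rewrite mulmxA hR mul1mx.
split=> //.
  split=> [j _|b /hil[u [u0 Au]]]; last by exists u.
  exact: cone_col.
move=> H [_ hH]; apply/setP => k; rewrite inE; apply/negPn/negP => kH.
have [|u [u0 [uH Au]]] := hH (col k A); first by rewrite intcv_col; apply: cone_col.
by apply: (irr k u u0 Au); apply: uH; apply/negP.
Qed.

(* On a fibre of A the cost and the group cost differ by a constant, so the group
   relaxation is refuted by a cheaper x'; cheaper, because x - x' is a relation which
   is nonnegative off some cell. *)
Lemma no_gomory d n (A : 'M[int]_(d, n)) (D : {set 'I_n} -> Prop) (b : 'cV[int]_d) x :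
  nonneg_vec x -> A *m x = b ->
  (forall u, nonneg_vec u -> A *m u = b -> u = x) ->
  (forall sigma, max_face D sigma -> exists x' tau j,
     [/\ feasG A sigma b x', D tau, forall i, i \notin tau -> x' i 0 <= x i 0,
         j \notin tau & x' j 0 < x j 0]) ->
  forall c, ~ supports A D c.
Proof.
move=> x0 Ax ux cells c [_ hD gom].
have DE : D = Delta A c by apply: funext => s; apply: propext.
have [sigma [ms sol]] := gom b (ex_intro _ x (conj x0 Ax)).
have [x' [tau [j [fx' [z hz] le jt lt]]]] : exists x' tau j,
    [/\ feasG A sigma b x', Delta A c tau, forall i, i \notin tau -> x' i 0 <= x i 0,
         j \notin tau & x' j 0 < x j 0].
  by rewrite -DE; apply: cells; rewrite DE.
have {}hz : witness A c tau z := hz.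
have [y hy] := ms.1; have ty j' (hj : j' \in sigma) := (hy j').1 hj.
have [x1 [[[_ ex1] ox1] x10]] := sol y ty.
have {ex1} e1 := ux _ x10 ex1; rewrite {}e1 in ox1.
have := ox1 _ fx'; rewrite -(lerD2l ((y *m intcv b) 0 0)) -{1}Ax -{1}fx'.2.
rewrite -!cost_gcost // leNgt => /negP; apply.
rewrite -subr_gt0 -costB (cost_gcost (A := A) (y := z) (sigma := tau)); last first.
  by move=> i; exact: (hz i).1.
rewrite mulmxBr Ax fx'.2 subrr intcv0 mulmx0 mxE add0r /gcost (bigD1 j) //=.
rewrite ltr_pwDl //.
  apply: mulr_gt0; first by rewrite subr_gt0; exact: (hz j).2.
  by rewrite ltr0z !mxE subr_gt0.
apply: sumr_ge0 => i /andP[hi _]; apply: mulr_ge0.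
  by rewrite subr_ge0; apply: ltW; exact: (hz i).2.
by rewrite ler0z !mxE subr_ge0 le.
Qed.

(** Unlike a big operator, this fold computes, so sums over explicit data unfold to terms that [lia]
    and [lra] can read. *)
Definition lsum (V : nmodType) m (F : nat -> V) : V :=
  foldr (fun i z => F i + z) 0 (iota 0 m).

Lemma lsumE (V : nmodType) m (F : nat -> V) : \sum_(i < m) F i = lsum m F.
Proof.
rewrite -(big_mkord xpredT) /index_iota subn0 /lsum.
by elim: (iota 0 m) => [|i s IH]; rewrite ?big_nil ?big_cons ?IH.
Qed.

(** * Matrices and certificates as lists of integers *)

Section Lists.
Variables (d n : nat) (cols : seq (seq int)).
Implicit Types (s : seq nat) (y c f : seq int) (N : seq (seq int)).

Definition entry (i j : nat) : int := (nth [::] cols j)`_i.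
Definition cols_mx : 'M[int]_(d, n) := \matrix_(i, j) entry i j.
Definition list_cv m (u : seq int) : 'cV[int]_m := \col_i u`_i.
Definition list_rv m (u : seq int) : 'rV[RR]_m := \row_i (u`_i)%:~R.
Definition cell s : {set 'I_n} := [set j | val j \in s].
Local Notation A := cols_mx.

Definition dotz y j : int := lsum d (fun i => y`_i * entry i j).

Lemma pair_list y j : pairing A (list_rv d y) j = (dotz y j)%:~R.
Proof.
rewrite /pairing mxE /dotz -lsumE rmorph_sum; apply: eq_bigr => i _.
by rewrite !mxE rmorphM.
Qed.

Lemma all_iota m (P : pred nat) : all P (iota 0 m) -> forall j : 'I_m, P j.
Proof. by move=> /allP h j; apply: h; rewrite mem_iota ltn_ord. Qed.

Definition check_witness c s y : bool :=
  all (fun j => if j \in s then dotz y j == c`_j else dotz y j < c`_j) (iota 0 n).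

Lemma check_witnessP c s y : check_witness c s y -> Delta A (list_rv n c) (cell s).
Proof.
move=> /all_iota h; exists (list_rv d y) => j; have := h j.
rewrite -/(pairing A _ j) pair_list mxE inE; case: ifP => _ hj; split=> //.
  by rewrite (eqP hj).
by rewrite ltr_int.
Qed.

Definition ev f (v : nat -> RR) : RR := lsum d (fun i => (f`_i)%:~R * v i).
(** Vectors become functions on [nat], with default 0, so that covering statements are arithmetic in
    [v 0], [v 1], and so on. *)
Definition coords (v : 'cV[RR]_d) (i : nat) : RR :=
  if insub i is Some k then v k 0 else 0.

Lemma coordsE v (i : 'I_d) : coords v i = v i 0.
Proof. by rewrite /coords valK. Qed.

Lemma ev_coords f v : ev f (coords v) = (list_rv d f *m v) 0 0.
Proof.
by rewrite /ev -lsumE mxE; apply: eq_bigr => i _; rewrite coordsE mxE.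
Qed.

Lemma ev_cone f v : all (fun j => 0 <= dotz f j) (iota 0 n) -> cone_of A setT v ->
  0 <= ev f (coords v).
Proof.
move=> /all_iota h /cone_comb[l [l0 _ ->]]; rewrite ev_coords mul_comb.
by apply: sumr_ge0 => j _; rewrite mulr_ge0 // pair_list ler0z.
Qed.

(* N lists the rows of D * A_s^-1 in the order of s. *)
Definition inv_row s N k : seq int := nth [::] N (index k s).
(** [D] clears denominators. The bound on [size N] makes [inv_row] default to the empty row for
    columns outside [s]. *)
Definition check_inverse s N (D : nat) : bool :=
  [&& (size N <= size s)%N, (0 < D)%N,
    all (fun i => all (fun i' =>
      lsum n (fun k => entry i k * (inv_row s N k)`_i') == ((i == i') * D)%N :> int)
      (iota 0 d)) (iota 0 d) &
    all (fun j => (j \in s) ==> all (fun k =>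
      dotz (inv_row s N k) j == ((k == j) * D)%N :> int) (iota 0 n)) (iota 0 n)].

Definition list_inverse s N (D : nat) : 'M[RR]_(n, d) :=
  \matrix_(k, i) (((inv_row s N k)`_i)%:~R / D%:R).

Lemma inv_row_out s N (k : nat) : (size N <= size s)%N -> k \notin s -> inv_row s N k = [::].
Proof. by move=> sz ks; rewrite /inv_row nth_default // memNindex. Qed.

Lemma check_inverseP s N D : check_inverse s N D ->
  inverse_on A (cell s) (list_inverse s N D).
Proof.
case/and4P => sz D0 hR hL.
have D0' : D%:R != 0 :> RR by rewrite pnatr_eq0 -lt0n.
split; first split.
- move=> j k; rewrite inE => hj; rewrite mxE inv_row_out // nth_nil mul0r //.
- move=> i k; rewrite inE => hi; have := all_iota hL i; rewrite hi /= => /all_iota /(_ k) /eqP e.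
  apply: (mulfI D0'); transitivity ((dotz (inv_row s N k) i)%:~R : RR); last first.
    by rewrite e -val_eqE /=; case: (_ == _); rewrite ?mul1n ?mulr1 ?mulr0.
  rewrite mxE mulr_sumr /dotz -lsumE rmorph_sum; apply: eq_bigr => l _.
  by rewrite !mxE rmorphM /= mulrA mulrC [D%:R * _]mulrC divfK // mulrC.
- apply/matrixP => i i'; have /eqP e := all_iota (all_iota hR i) i'.
  apply: (mulfI D0'); transitivity ((lsum n (fun k => entry i k * (inv_row s N k)`_i'))%:~R : RR).
    rewrite mxE mulr_sumr -lsumE rmorph_sum; apply: eq_bigr => l _.
    by rewrite !mxE rmorphM /= mulrCA [D%:R * _]mulrC divfK.
  by rewrite e mxE -val_eqE /=; case: (_ == _); rewrite ?mul1n ?mulr1 ?mulr0.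
Qed.

Lemma check_cone s N D v : check_inverse s N D ->
  all (fun r => 0 <= ev r (coords v)) N -> cone_of A (cell s) v.
Proof.
move=> chk /allP h; apply/(coneP (check_inverseP chk)) => k.
have [hk|hk] := ltnP (index (val k) s) (size N); last first.
  have e : inv_row s N k = [::] by rewrite /inv_row nth_default.
  by rewrite mxE big1 // => i _; rewrite mxE e nth_nil !mul0r.
have := h _ (mem_nth [::] hk); rewrite -/(inv_row s N k) ev_coords => hv.
have -> : (list_inverse s N D *m v) k 0 = (list_rv d (inv_row s N k) *m v) 0 0 / D%:R.
  by rewrite !mxE mulr_suml; apply: eq_bigr => i _; rewrite !mxE mulrAC.
by rewrite mulr_ge0 // invr_ge0 ler0n.
Qed.

Lemma check_indep s N D : check_inverse s N D -> indep A (cell s).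
Proof.
move=> /check_inverseP hM l lout l0 j.
by rewrite -(inv_comb hM lout j) l0 mulmx0 mxE.
Qed.

Lemma check_inverse1 s N : check_inverse s N 1 ->
  A *m (\matrix_(k < n, i < d) (inv_row s N k)`_i) = 1%:M.
Proof.
case/and4P => _ _ hR _; apply/matrixP => i i'.
have /eqP e := all_iota (all_iota hR i) i'; rewrite mxE mxE -val_eqE.
transitivity (lsum n (fun k => entry i k * (inv_row s N k)`_i')).
  by rewrite -lsumE; apply: eq_bigr => k _; rewrite !mxE.
by rewrite e muln1; case: (_ == _).
Qed.

(** For a unimodular cell the inverse is integral, so lattice points have integer coordinates. *)
Lemma check_lattice_cone s N (b : 'cV[int]_d) : check_inverse s N 1 ->
  cone_of A (cell s) (intcv b) -> inNA A b.
Proof.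
move=> chk /(coneP (check_inverseP chk)) h.
exists ((\matrix_(k < n, i < d) (inv_row s N k)`_i) *m b); split.
  move=> k; have := h k; set x := (_ *m b) k 0; suff -> : (list_inverse s N 1 *m intcv b) k 0 = x%:~R.
    by rewrite ler0z.
  rewrite /x !mxE rmorph_sum; apply: eq_bigr => i _.
  by rewrite !mxE rmorphM /= divr1.
by rewrite mulmxA check_inverse1 // mul1mx.
Qed.

Definition icoords (u : 'cV[int]_n) (k : nat) : int :=
  if insub k is Some j then u j 0 else 0.

Lemma icoordsE u (j : 'I_n) : icoords u j = u j 0.
Proof. by rewrite /icoords valK. Qed.

Definition check_mul (f : nat -> int) (b : seq int) : bool :=
  all (fun i => lsum n (fun j => entry i j * f j) == b`_i) (iota 0 d).

Lemma check_mulP u b : A *m u = list_cv d b -> check_mul (icoords u) b.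
Proof.
move/colP => h; apply/allP => i; rewrite mem_iota => hi.
have := h (Ordinal hi); rewrite !mxE => <-; apply/eqP; rewrite -lsumE.
by apply: eq_bigr => j _; rewrite icoordsE mxE.
Qed.

Lemma mul_list x b : check_mul (nth 0 x) b -> A *m list_cv n x = list_cv d b.
Proof.
move=> /all_iota h; apply/colP => i; have /eqP e := h i; rewrite [RHS]mxE -e.
by rewrite mxE -lsumE; apply: eq_bigr => j _; rewrite !mxE.
Qed.

Record cell_cert := CellCert { gens : seq nat; inv_rows : seq (seq int); index_of : nat }.

(** Stated for the polyhedron cut out by [F], which contains the cone as soon as all columns satisfy
    [F]; it thus becomes a claim of linear arithmetic. *)
Definition covers (F : seq (seq int)) (T : seq cell_cert) : Prop :=
  forall v : nat -> RR, all (fun f => 0 <= ev f v) F ->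
    has (fun t => all (fun r => 0 <= ev r v) (inv_rows t)) T.

Definition check_cells (T : seq cell_cert) : bool :=
  all (fun t => check_inverse (gens t) (inv_rows t) (index_of t)) T.

Definition check_facets (F : seq (seq int)) : bool :=
  all (fun f => all (fun j => 0 <= dotz f j) (iota 0 n)) F.

Lemma covers_cone F T v : check_facets F -> check_cells T -> covers F T ->
  cone_of A setT v -> exists k, (k < size T)%N /\
    cone_of A (cell (gens (nth (CellCert [::] [::] 0) T k))) v.
Proof.
move=> hF hT cov hv; have /cov : all (fun f => 0 <= ev f (coords v)) F.
  by apply/allP => f hf; apply: ev_cone hv; exact: (allP hF).
move=> h; exists (find (fun t => all (fun r => 0 <= ev r (coords v)) (inv_rows t)) T).
rewrite -has_find h; split=> //; have := nth_find (CellCert [::] [::] 0) h.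
apply: check_cone; apply: (all_nthP _ hT); by rewrite -has_find.
Qed.

Definition check_regular c T (Y : seq (seq int)) : bool :=
  [&& check_cells T, size Y == size T &
      all (fun p => check_witness c (gens p.1) p.2) (zip T Y)].

Lemma list_regular c F T Y : check_facets F -> check_regular c T Y -> covers F T ->
  is_triangulation A (Delta A (list_rv n c)) /\
  forall sigma, max_face (Delta A (list_rv n c)) sigma ->
    exists k, (k < size T)%N /\ sigma = cell (gens (nth (CellCert [::] [::] 0) T k)).
Proof.
move=> hF /and3P[hT /eqP sY hY] cov.
pose g k := cell (gens (nth (CellCert [::] [::] 0) T k)).
have TD k : (k < size T)%N -> Delta A (list_rv n c) (g k).
  move=> hk; apply: (@check_witnessP _ _ (nth [::] Y k)).
  have := all_nthP (CellCert [::] [::] 0, [::]) hY k.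
  by rewrite size_zip sY minnn nth_zip //; apply.
have [|||tri sub] := @Delta_triangulation _ _ A (list_rv n c)
  (fun sigma => exists k, (k < size T)%N /\ sigma = g k).
- by move=> s [k [hk ->]]; exact: TD.
- move=> s [k [hk ->]]; apply: check_indep; exact: (all_nthP _ hT).
- move=> v /(covers_cone hF hT cov)[k [hk hc]]; by exists (g k) => //; exists k.
split=> // sigma [/sub[_ [k [hk ->]] sk] mx]; exists k; split=> //.
exact: esym (mx _ (TD _ hk) sk).
Qed.

Lemma list_standing y F T : all (fun j => 0 < dotz y j) (iota 0 n) ->
  check_facets F -> check_cells T -> all (fun t => index_of t == 1%N) T -> (0 < size T)%N ->
  covers F T ->
  (forall i j, (i < n)%N -> (j < n)%N ->
     all (fun k => entry k i == entry k j) (iota 0 d) -> i = j) ->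
  (forall k (f : nat -> int), (k < n)%N -> all (fun j => 0 <= f j) (iota 0 n) ->
     check_mul f (mkseq (fun i => entry i k) d) -> f k <> 0) ->
  standing A.
Proof.
move=> hy hF hT h1 T0 cov inj irr.
have ck k : (k < size T)%N ->
    check_inverse (gens (nth (CellCert [::] [::] 0) T k)) (inv_rows (nth (CellCert [::] [::] 0) T k)) 1.
  move=> hk; have := @all_nthP _ _ _ (CellCert [::] [::] 0) hT k hk.
  by have /eqP -> := all_nthP (CellCert [::] [::] 0) h1 k hk.
apply: (standing_criterion _ (check_inverse1 (ck 0%N T0)) (y := list_rv d y)).
- by move=> j; rewrite pair_list ltr0z; exact: (all_iota hy).
- by move=> b /(covers_cone hF hT cov)[k [hk]]; exact: check_lattice_cone (ck _ hk).
- move=> i j /colP e; apply: val_inj; apply: (inj _ _ (ltn_ord i) (ltn_ord j)).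
  apply/allP => k; rewrite mem_iota => hk.
  by have := e (Ordinal hk); rewrite !mxE => ->.
- move=> k u u0 e; rewrite -icoordsE; apply: irr => //.
    by apply/allP => j; rewrite mem_iota => hj; rewrite (icoordsE u (Ordinal hj)).
  apply: check_mulP; rewrite e; apply/colP => i; rewrite !mxE nth_mkseq //.
Qed.

(* The cheaper point x' refutes the cell s; x - x' is nonnegative off the cell s' and
   positive at j, which is not in s'. *)
Definition check_refutation (S : seq (seq nat)) x b s (r : seq int * seq nat * nat) : bool :=
  let: (x', s', j) := r in
  [&& s' \in S, check_mul (nth 0 x') b,
      all (fun k => (k \in s) || (0 <= x'`_k)) (iota 0 n),
      all (fun k => (k \in s') || (x'`_k <= x`_k)) (iota 0 n),
      (j < n)%N, j \notin s' & x'`_j < x`_j].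

Lemma list_no_gomory c F T Y x b (rs : seq (seq int * seq nat * nat)) :
  check_facets F -> check_regular c T Y -> covers F T ->
  all (fun j => 0 <= x`_j) (iota 0 n) -> check_mul (nth 0 x) b ->
  (forall f : nat -> int, all (fun j => 0 <= f j) (iota 0 n) -> check_mul f b ->
     all (fun j => f j == x`_j) (iota 0 n)) ->
  all (fun s => has (check_refutation (map gens T) x b s) rs) (map gens T) ->
  forall c' : 'rV[RR]_n, ~ supports A (Delta A (list_rv n c)) c'.
Proof.
move=> hF hreg cov hx hb fib href.
have [tri mf] := list_regular hF hreg cov.
apply: (@no_gomory _ _ A _ (list_cv d b) (list_cv n x)).
- by move=> j; rewrite mxE; exact: (all_iota hx).
- exact: mul_list.
- move=> u u0 /check_mulP hu; apply/colP => j; rewrite mxE -icoordsE.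
  have /fib/(_ hu)/all_iota h : all (fun j => 0 <= icoords u j) (iota 0 n).
    by apply/allP => k; rewrite mem_iota => hk; rewrite (icoordsE u (Ordinal hk)).
  exact/eqP.
move=> sigma /mf[k [hk ->]].
have hk' : gens (nth (CellCert [::] [::] 0) T k) \in map gens T.
  by rewrite -(nth_map _ [::]) // mem_nth // size_map.
have in_map t : t \in map gens T -> exists k, (k < size T)%N /\
    t = gens (nth (CellCert [::] [::] 0) T k).
  move=> ht; exists (index t (map gens T)); rewrite -(size_map gens) index_mem ht; split=> //.
  by rewrite -(nth_map _ [::]) ?nth_index // -(size_map gens) index_mem.
have /hasP[[[x' s'] j] _] := allP href _ hk'.
case/and5P=> /in_map[k' [hk1 es']] hx' /all_iota hs /all_iota hle /and3P[hj js lt].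
exists (list_cv n x'), (cell s'), (Ordinal hj); split.
- split; last exact: mul_list.
  by move=> i; rewrite inE mxE => hi; have := hs i; rewrite (negbTE hi).
- case/and3P: hreg => hT /eqP sY hY; apply: (@check_witnessP _ _ (nth [::] Y k')).
  rewrite es'; have := all_nthP (CellCert [::] [::] 0, [::]) hY k'.
  by rewrite size_zip sY minnn nth_zip //; apply.
- by move=> i; rewrite inE !mxE => hi; have := hle i; rewrite (negbTE hi).
- by rewrite inE.
- by rewrite !mxE.
Qed.

End Lists.

Lemma bad_regular_triangulation d n (A : 'M[int]_(d, n)) c : standing A ->
  is_triangulation A (Delta A c) -> (forall c', ~ supports A (Delta A c) c') ->
  exists D, regular_triangulation A D /\ (forall c', ~ supports A D c') /\ ~ Delta_normal A D.
Proof.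
move=> std tri no; exists (Delta A c); split; first by split=> //; exists c.
split=> // dn; have [c'] := Delta_normal_supports (standing_rank std) (col_neq0 std) tri dn.
exact: no.
Qed.

(** * Two triangulations without Gomory families *)

(* Covering proofs are decision trees: a split asks for the side of a wall between cells, a leaf
   names the cell reached. *)
Tactic Notation "cover_split" constr(v) constr(d) uconstr(f) :=
  let H := fresh in have [H|H] := leP (0 : RR) (ev d f v); rewrite /ev /lsum /= in H.
Ltac cover_leaf i :=
  apply/(has_nthP (CellCert [::] [::] 0)); exists i; [by [] |];
  rewrite /ev /lsum /=; repeat (apply/andP; split); try by []; lra.
Definition ex3_cols : seq (seq int) :=
  [:: [:: 1; 0; 0]; [:: 0; 1; 0]; [:: 1; 1; 1]; [:: 1; 1; 2]; [:: 1; 2; 3]; [:: 1; 2; 4]].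

Definition ex3_facets : seq (seq int) :=
  [:: [:: 0; 0; 1]; [:: 0; 2; - 1]; [:: 4; 0; - 1]].

Definition ex3_cells : seq cell_cert :=
  [:: CellCert [:: 0; 1; 2]%N [:: [:: 1; 0; - 1]; [:: 0; 1; - 1]; [:: 0; 0; 1]] 1;
     CellCert [:: 0; 2; 3]%N [:: [:: 1; - 1; 0]; [:: 0; 2; - 1]; [:: 0; - 1; 1]] 1;
     CellCert [:: 1; 2; 4]%N [:: [:: - 1; 2; - 1]; [:: 3; 0; - 1]; [:: - 1; 0; 1]] 2;
     CellCert [:: 1; 4; 5]%N [:: [:: - 2; 1; 0]; [:: 4; 0; - 1]; [:: - 3; 0; 1]] 1;
     CellCert [:: 2; 3; 5]%N [:: [:: 0; 2; - 1]; [:: 2; - 3; 1]; [:: - 1; 1; 0]] 1;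
     CellCert [:: 2; 4; 5]%N [:: [:: 2; - 1; 0]; [:: - 2; 3; - 1]; [:: 1; - 2; 1]] 1].

(** A second triangulation of the same cone, with all cells of index 1, serves to prove normality;
    [ex3_cells] has a cell of index 2. *)
Definition ex3_unimodular_cells : seq cell_cert :=
  [:: CellCert [:: 0; 1; 2]%N [:: [:: 1; 0; - 1]; [:: 0; 1; - 1]; [:: 0; 0; 1]] 1;
     CellCert [:: 0; 2; 3]%N [:: [:: 1; - 1; 0]; [:: 0; 2; - 1]; [:: 0; - 1; 1]] 1;
     CellCert [:: 1; 2; 3]%N [:: [:: - 1; 1; 0]; [:: 2; 0; - 1]; [:: - 1; 0; 1]] 1;
     CellCert [:: 1; 3; 4]%N [:: [:: 1; 1; - 1]; [:: 3; 0; - 1]; [:: - 2; 0; 1]] 1;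
     CellCert [:: 1; 4; 5]%N [:: [:: - 2; 1; 0]; [:: 4; 0; - 1]; [:: - 3; 0; 1]] 1;
     CellCert [:: 3; 4; 5]%N [:: [:: 2; - 1; 0]; [:: 0; 2; - 1]; [:: - 1; - 1; 1]] 1].

Lemma ex3_cells_cover : covers 3 ex3_facets ex3_cells.
Proof.
move=> v hv; rewrite /ev /lsum /= in hv.
cover_split v 3%N [:: 1; 0; - 1].
cover_split v 3%N [:: 0; 1; - 1].
cover_leaf 0%N.
cover_leaf 1%N.
cover_split v 3%N [:: 2; - 1; 0].
cover_split v 3%N [:: 2; - 3; 1].
cover_split v 3%N [:: 1; - 1; 0].
cover_leaf 1%N.
cover_leaf 4%N.
cover_split v 3%N [:: 1; - 2; 1].
cover_leaf 5%N.
cover_leaf 2%N.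
cover_split v 3%N [:: 3; 0; - 1].
cover_leaf 2%N.
cover_leaf 3%N.
Qed.

Lemma ex3_unimodular_cells_cover : covers 3 ex3_facets ex3_unimodular_cells.
Proof.
move=> v hv; rewrite /ev /lsum /= in hv.
cover_split v 3%N [:: 2; 0; - 1].
cover_split v 3%N [:: 1; 0; - 1].
cover_split v 3%N [:: 0; 1; - 1].
cover_leaf 0%N.
cover_leaf 1%N.
cover_split v 3%N [:: 1; - 1; 0].
cover_leaf 1%N.
cover_leaf 2%N.
cover_split v 3%N [:: 2; - 1; 0].
cover_split v 3%N [:: 1; 1; - 1].
cover_leaf 3%N.
cover_leaf 5%N.
cover_split v 3%N [:: 3; 0; - 1].
cover_leaf 3%N.
cover_leaf 4%N.
Qed.

Definition ex3_refutations : seq (seq int * seq nat * nat) :=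
  [:: ([:: - 1; 0; 2; 0; 0; 0], [:: 0; 1; 2]%N, 3%N);
     ([:: - 1; 0; 2; 0; 0; 0], [:: 0; 2; 3]%N, 1%N);
     ([:: 0; 0; 0; 0; 2; - 1], [:: 1; 4; 5]%N, 3%N);
     ([:: 0; 0; 2; - 2; 0; 1], [:: 2; 3; 5]%N, 1%N);
     ([:: 0; 0; 0; 0; 2; - 1], [:: 2; 4; 5]%N, 1%N);
     ([:: 0; 1; 1; 0; - 1; 1], [:: 2; 3; 5]%N, 4%N)].

Definition ex4_cols : seq (seq int) :=
  [:: [:: 1; 0; 0; 2]; [:: 1; 1; 0; 1]; [:: 1; 1; 0; 2]; [:: 1; 1; 1; 2]; [:: 1; 1; 2; 2]; [:: 1; 2; 1; 0]; [:: 1; 2; 1; 1]].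

Definition ex4_facets : seq (seq int) :=
  [:: [:: - 6; 4; - 2; 3]; [:: - 2; 1; 0; 1]; [:: 0; 0; 1; 0]; [:: 1; - 1; 1; 0]; [:: 2; 0; 0; - 1]; [:: 3; - 1; - 1; 0]; [:: 3; - 1; 0; - 1]].

Definition ex4_cells : seq cell_cert :=
  [:: CellCert [:: 0; 1; 2; 5]%N [:: [:: 1; - 1; 1; 0]; [:: 2; 0; - 2; - 1]; [:: - 2; 1; 0; 1]; [:: 0; 0; 1; 0]] 1;
     CellCert [:: 0; 2; 3; 6]%N [:: [:: 3; - 1; 0; - 1]; [:: - 2; 1; - 1; 1]; [:: - 2; 0; 1; 1]; [:: 2; 0; 0; - 1]] 1;
     CellCert [:: 0; 2; 5; 6]%N [:: [:: 1; - 1; 1; 0]; [:: 0; 1; - 2; 0]; [:: 2; 0; - 1; - 1]; [:: - 2; 0; 2; 1]] 1;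
     CellCert [:: 0; 3; 4; 5]%N [:: [:: 4; - 2; 0; - 1]; [:: - 6; 4; - 2; 3]; [:: 2; - 2; 2; - 1]; [:: 2; 0; 0; - 1]] 2;
     CellCert [:: 0; 3; 5; 6]%N [:: [:: 1; 0; - 1; 0]; [:: 0; - 1; 2; 0]; [:: 2; - 1; 1; - 1]; [:: - 2; 2; - 2; 1]] 1;
     CellCert [:: 3; 4; 5; 6]%N [:: [:: 3; - 1; - 1; 0]; [:: - 1; 0; 1; 0]; [:: 3; - 1; 0; - 1]; [:: - 4; 2; 0; 1]] 1].

Definition ex4_unimodular_cells : seq cell_cert :=
  [:: CellCert [:: 0; 1; 2; 3]%N [:: [:: 1; - 1; 0; 0]; [:: 2; 0; 0; - 1]; [:: - 2; 1; - 1; 1]; [:: 0; 0; 1; 0]] 1;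
     CellCert [:: 0; 1; 3; 4]%N [:: [:: 1; - 1; 0; 0]; [:: 2; 0; 0; - 1]; [:: - 4; 2; - 1; 2]; [:: 2; - 1; 1; - 1]] 1;
     CellCert [:: 0; 1; 4; 5]%N [:: [:: 5; - 3; 1; - 2]; [:: - 6; 4; - 2; 3]; [:: - 2; 1; 0; 1]; [:: 4; - 2; 1; - 2]] 1;
     CellCert [:: 1; 2; 3; 6]%N [:: [:: 3; - 1; 0; - 1]; [:: - 2; 1; - 1; 1]; [:: 1; - 1; 1; 0]; [:: - 1; 1; 0; 0]] 1;
     CellCert [:: 1; 3; 4; 5]%N [:: [:: 4; - 2; 0; - 1]; [:: - 5; 3; - 1; 2]; [:: 3; - 2; 1; - 1]; [:: - 1; 1; 0; 0]] 1;
     CellCert [:: 1; 3; 5; 6]%N [:: [:: 1; 0; - 1; 0]; [:: 1; - 1; 1; 0]; [:: 2; - 1; 1; - 1]; [:: - 3; 2; - 1; 1]] 1;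
     CellCert [:: 3; 4; 5; 6]%N [:: [:: 3; - 1; - 1; 0]; [:: - 1; 0; 1; 0]; [:: 3; - 1; 0; - 1]; [:: - 4; 2; 0; 1]] 1].

Lemma ex4_cells_cover : covers 4 ex4_facets ex4_cells.
Proof.
move=> v hv; rewrite /ev /lsum /= in hv.
cover_split v 4%N [:: 1; 0; - 1; 0].
cover_split v 4%N [:: 0; 1; - 2; 0].
cover_split v 4%N [:: 2; 0; - 1; - 1].
cover_split v 4%N [:: 2; 0; - 2; - 1].
cover_leaf 0%N.
cover_leaf 2%N.
cover_leaf 1%N.
cover_split v 4%N [:: 2; - 1; 1; - 1].
cover_split v 4%N [:: 2; - 2; 2; - 1].
cover_leaf 3%N.
cover_leaf 4%N.
cover_leaf 1%N.
cover_split v 4%N [:: 4; - 2; 0; - 1].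
cover_leaf 3%N.
cover_leaf 5%N.
Qed.

Lemma ex4_unimodular_cells_cover : covers 4 ex4_facets ex4_unimodular_cells.
Proof.
move=> v hv; rewrite /ev /lsum /= in hv.
cover_split v 4%N [:: 1; - 1; 0; 0].
cover_split v 4%N [:: 2; - 1; 1; - 1].
cover_split v 4%N [:: 4; - 2; 1; - 2].
cover_leaf 2%N.
cover_leaf 1%N.
cover_leaf 0%N.
cover_split v 4%N [:: 3; - 2; 1; - 1].
cover_split v 4%N [:: 4; - 2; 0; - 1].
cover_split v 4%N [:: 5; - 3; 1; - 2].
cover_leaf 2%N.
cover_leaf 4%N.
cover_leaf 6%N.
cover_split v 4%N [:: 1; 0; - 1; 0].
cover_split v 4%N [:: 2; - 1; 1; - 1].
cover_leaf 5%N.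
cover_leaf 3%N.
cover_leaf 6%N.
Qed.

Definition ex4_refutations : seq (seq int * seq nat * nat) :=
  [:: ([:: 2; - 3; 1; 0; 0; 2; 0], [:: 0; 1; 2; 5]%N, 4%N);
     ([:: 1; 0; - 1; 1; 0; 0; 1], [:: 0; 2; 3; 6]%N, 1%N);
     ([:: 2; 0; - 2; 0; 0; - 1; 3], [:: 0; 2; 5; 6]%N, 1%N);
     ([:: 0; 0; 0; 2; 0; 1; - 1], [:: 0; 3; 5; 6]%N, 1%N);
     ([:: 0; 0; 0; 2; 0; 1; - 1], [:: 3; 4; 5; 6]%N, 1%N);
     ([:: 1; 0; 0; - 1; 1; 0; 1], [:: 0; 2; 5; 6]%N, 1%N)].

Local Notation A3 := (cols_mx 3 6 ex3_cols).
Local Notation A4 := (cols_mx 4 7 ex4_cols).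
Definition ex3_cost : seq int := [:: 4; 4; 0; 2; 2; 2].
Definition ex4_cost : seq int := [:: 0; 4; 2; 0; 2; 0; 0].

Lemma ex3_facetsP : check_facets 3 6 ex3_cols ex3_facets. Proof. by vm_compute. Qed.
Lemma ex4_facetsP : check_facets 4 7 ex4_cols ex4_facets. Proof. by vm_compute. Qed.

(** The listed vectors are the linear functionals agreeing with the heights on the successive
    cells. *)
Lemma ex3_regular : check_regular 3 6 ex3_cols ex3_cost ex3_cells
  [:: [:: 4; 4; -8]; [:: 4; -6; 2]; [:: -3; 4; -1]; [:: -6; 4; 0]; [:: 2; -4; 2]; [:: -2; 2; 0]].
Proof. by vm_compute. Qed.

Lemma ex4_regular : check_regular 4 7 ex4_cols ex4_cost ex4_cells
  [:: [:: 4; 2; -8; -2]; [:: -4; 2; -2; 2]; [:: 0; 2; -4; 0]; [:: 2; -2; 2; -1];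
      [:: 0; 0; 0; 0]; [:: -2; 0; 2; 0]].
Proof. by vm_compute. Qed.

Lemma ex3_standing : standing A3.
Proof.
apply: (@list_standing _ _ _ [:: 1; 1; 1] ex3_facets ex3_unimodular_cells).
- by vm_compute.
- exact: ex3_facetsP.
- by vm_compute.
- by [].
- by [].
- exact: ex3_unimodular_cells_cover.
- by case=> [|[|[|[|[|[|//]]]]]] [|[|[|[|[|[|//]]]]]].
- move=> k f; rewrite /check_mul /lsum /entry /=.
  by case: k => [|[|[|[|[|[|//]]]]]] _ /=; lia.
Qed.

Lemma ex4_standing : standing A4.
Proof.
apply: (@list_standing _ _ _ [:: 1; 0; 0; 0] ex4_facets ex4_unimodular_cells).
- by vm_compute.
- exact: ex4_facetsP.
- by vm_compute.
- by [].
- by [].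
- exact: ex4_unimodular_cells_cover.
- by case=> [|[|[|[|[|[|[|//]]]]]]] [|[|[|[|[|[|[|//]]]]]]].
- move=> k f; rewrite /check_mul /lsum /entry /=.
  by case: k => [|[|[|[|[|[|[|//]]]]]]] _ /=; lia.
Qed.

Lemma ex3_no_gomory : forall c, ~ supports A3 (Delta A3 (list_rv 6 ex3_cost)) c.
Proof.
(* [b] is half the sum of columns 1, 2, 4, which generate the cell of index 2; its only nonnegative
   representation is column 1 plus column 3. *)
apply: (@list_no_gomory _ _ _ _ _ _ _ [:: 0; 1; 0; 1; 0; 0] [:: 1; 2; 2] ex3_refutations
  ex3_facetsP ex3_regular ex3_cells_cover).
- by vm_compute.
- by vm_compute.
- move=> f; rewrite /check_mul /lsum /entry /=; lia.
- by vm_compute.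
Qed.

Lemma ex4_no_gomory : forall c, ~ supports A4 (Delta A4 (list_rv 7 ex4_cost)) c.
Proof.
(* Here [b] is half the sum of columns 0, 3, 4, 5, again the cell of index 2, and equals column 1
   plus column 4. *)
apply: (@list_no_gomory _ _ _ _ _ _ _ [:: 0; 1; 0; 0; 1; 0; 0] [:: 2; 2; 2; 3] ex4_refutations
  ex4_facetsP ex4_regular ex4_cells_cover).
- by vm_compute.
- by vm_compute.
- move=> f; rewrite /check_mul /lsum /entry /=; lia.
- by vm_compute.
Qed.

Lemma ex3_not_graded : ~ graded A3.
Proof.
move=> /graded_unit[w hw].
have e (j : nat) : (j < 6)%N -> lsum 3 (fun i => coords w^T i * (entry ex3_cols i j)%:~R) = 1.
  move=> hj; rewrite -[RHS](hw (Ordinal hj)) /pairing mxE -lsumE; apply: eq_bigr => i _.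
  by rewrite coordsE !mxE.
have := e 0%N isT; have := e 1%N isT; have := e 2%N isT; have := e 3%N isT.
(* Columns 0, 1, 2 force w = (1, 1, -1), which is 0 on column 3. *)
by rewrite /lsum /entry /=; lra.
Qed.

Lemma ex4_graded : graded A4.
Proof.
exists (list_rv 4 [:: 1; 0; 0; 0]), 1; split; first exact: oner_neq0.
move=> j; rewrite -/(pairing A4 _ j) pair_list.
suff /eqP -> : dotz 4 ex4_cols [:: 1; 0; 0; 0] j == 1 by [].
by apply: (@all_iota 7 (fun j => dotz 4 ex4_cols [:: 1; 0; 0; 0] j == 1)).
Qed.

Theorem theorem5p5 :
  (* (i) *)
  (forall (d n : nat) (A : 'M[int]_(d, n)), standing A ->
     (d = 1%N \/ d = 2%N \/ (graded A /\ d = 3%N)) ->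
     forall D : {set 'I_n} -> Prop, regular_triangulation A D ->
       exists c : 'rV[RR]_n, supports A D c) /\
  (* (ii) *)
  (forall (d n : nat) (A : 'M[int]_(d, n)), standing A ->
     d = 2%N -> graded A ->
     forall D : {set 'I_n} -> Prop, regular_triangulation A D ->
       (exists c : 'rV[RR]_n, supports A D c) /\
       (forall c c' : 'rV[RR]_n, supports A D c -> supports A D c' ->
          forall x, Oc A c x <-> Oc A c' x)) /\
  (* (iii), d = 3, not graded *)
  (exists (n : nat) (A : 'M[int]_(3, n)), standing A /\ ~ graded A /\
     exists D : {set 'I_n} -> Prop, regular_triangulation A D /\
       (forall c : 'rV[RR]_n, ~ supports A D c) /\ ~ Delta_normal A D) /\
  (* (iii), d = 4, graded *)
  (exists (n : nat) (A : 'M[int]_(4, n)), standing A /\ graded A /\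
     exists D : {set 'I_n} -> Prop, regular_triangulation A D /\
       (forall c : 'rV[RR]_n, ~ supports A D c) /\ ~ Delta_normal A D).
Proof.
split; [exact: part_i | split; [|split]].
- move=> d n A std d2; move: A std; rewrite d2; exact: part_ii.
- have [tri _] := list_regular ex3_facetsP ex3_regular ex3_cells_cover.
  exists 6%N, (cols_mx 3 6 ex3_cols); split; first exact: ex3_standing.
  split; first exact: ex3_not_graded.
  exact: bad_regular_triangulation ex3_standing tri ex3_no_gomory.
- have [tri _] := list_regular ex4_facetsP ex4_regular ex4_cells_cover.
  exists 7%N, (cols_mx 4 7 ex4_cols); split; first exact: ex4_standing.
  split; first exact: ex4_graded.
  exact: bad_regular_triangulation ex4_standing tri ex4_no_gomory.
Qed.
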